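(* Let $I \subseteq \mathbb{R}[x_1,\dots,x_n]$ be an ideal with $I \subseteq \langle x_1,\dots,x_n\rangle$, and let $X = \{x\in\mathbb{R}^n : f(x)=0 \text{ for all } f\in I\}$ be its real zero set (so $0\in X$). Let $\mathbb{R}\{x_1,\dots,x_n\}$ be the ring of convergent power series, let $\hat I \subseteq \mathbb{R}\{x_1,\dots,x_n\}$ be the ideal of all $f$ for which there is a Euclidean neighborhood $U$ of $0$ such that $f$ converges on $U$ and $f\equiv 0$ on $X\cap U$, and let $\hat{\mathcal{O}} = \mathbb{R}\{x_1,\dots,x_n\}/\hat I$. Then the origin is a manifold point of $X$ if and only if $\hat{\mathcal{O}}$ is a regular local ring.
   Context: A $d$-dimensional analytic submanifold of $\mathbb{R}^n$ is a set $M\subseteq\mathbb{R}^n$ such that for every $p\in M$ there are a Euclidean open neighborhood $U\subseteq\mathbb{R}^n$ of $p$ and a real-analytic diffeomorphism $\phi\colon U\to V$ onto an open set $V\subseteq\mathbb{R}^n$ with $M\cap U=\{x\in U : \phi_{d+1}(x)=\dots=\phi_n(x)=0\}$. A point $p$ of a set $X\subseteq\mathbb{R}^n$ is a manifold point of $X$ if there is a Euclidean open neighborhood $U$ of $p$ such that $X\cap U$ is an analytic submanifold of $\mathbb{R}^n$ (of some dimension $0\le d\le n$). *)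

(* Defs.v *)
From HB Require Import structures.
From mathcomp Require Import all_boot all_order all_algebra.
From mathcomp Require Import all_classical all_reals.
From mathcomp Require Import finmap ereal topology normedtype sequences esum.
(* The notations of mpoly.v clash with those of mathcomp-analysis. *)
From mathcomp Require ssrcomplements mpoly.
Import -(notations) mpoly.

Set Implicit Arguments.
Unset Strict Implicit.
Unset Printing Implicit Defensive.

Import Order.TTheory GRing.Theory Num.Theory.
Import numFieldNormedType.Exports.

Local Open Scope classical_set_scope.
Local Open Scope ring_scope.

Section CommutativeAlgebra.
Variable A : comNzRingType.
Implicit Types (J P M : set A).

Definition ideal J : Prop :=
  [/\ J 0, (forall x y, J x -> J y -> J (x + y))
    & (forall a x, J x -> J (a * x))].

Definition ideal_span (S : set A) : set A := smallest ideal S.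

Definition prime_ideal P : Prop :=
  [/\ ideal P, ~ P 1 & forall x y, P (x * y) -> P x \/ P y].

Definition maximal_ideal M : Prop :=
  [/\ ideal M, ~ M 1 & forall J, ideal J -> ~ J 1 -> M `<=` J -> J = M].

Definition noetherian : Prop :=
  forall J, ideal J -> exists s : seq A, J = ideal_span [set` s].

(* c 0 `<` c 1 `<` ... `<` c d, of length d; c i is irrelevant for i > d. *)
Definition prime_chain (d : nat) (c : nat -> set A) : Prop :=
  (forall i, (i <= d)%N -> prime_ideal (c i)) /\
  (forall i, (i < d)%N -> c i `<` c i.+1).

Definition has_krull_dim (d : nat) : Prop :=
  (exists c, prime_chain d c) /\
  (forall e c, prime_chain e c -> (e <= d)%N).

Definition regular_local_ring : Prop :=
  noetherian /\
  exists (M : set A) (d : nat),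
    [/\ maximal_ideal M, (forall M', maximal_ideal M' -> M' = M),
        has_krull_dim d
      & exists x : 'I_d -> A, M = ideal_span (range x)].

End CommutativeAlgebra.

Section FormalPowerSeries.
Variables (R : realType) (n : nat).

(* An alias, so that the product below does not compete with the pointwise
   product of functions. *)
Definition fps := multinom n -> R.

HB.instance Definition _ := GRing.Zmodule.copy fps (multinom n -> R).

Definition fps_one : fps := fun m => (m == mnm0)%:R.

Definition fps_mul (f g : fps) : fps := fun m =>
  \sum_(k : bmultinom n (mdeg m).+1 | lem k m) f k * g (mnm_sub m k).

Lemma fps_addE (f g : fps) m : (f + g) m = f m + g m.
Proof. by []. Qed.

Definition fps_trunc (N : nat) (f : fps) : mpoly n R :=
  \sum_(k : bmultinom n N) f k *: mpolyX R k.

Lemma mcoeff_fps_trunc N f m :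
  mcoeff m (fps_trunc N f) = if (mdeg m < N)%N then f m else 0.
Proof.
rewrite /fps_trunc raddf_sum /=; case: ifP => mN.
  rewrite (bigD1 (BMultinom mN)) //= mcoeffZ mcoeffX eqxx mulr1 big1 ?addr0//.
  move=> k /negbTE; rewrite bmeqP /= => km.
  by rewrite mcoeffZ mcoeffX km mulr0.
rewrite big1// => k _; rewrite mcoeffZ mcoeffX; case: eqP => [km|]; last first.
  by rewrite mulr0.
by move: (bmdeg k); rewrite km mN.
Qed.

Lemma eq_mcoeffM (p p' q q' : mpoly n R) m :
  (forall k, (mdeg k <= mdeg m)%N -> mcoeff k p = mcoeff k p') ->
  (forall k, (mdeg k <= mdeg m)%N -> mcoeff k q = mcoeff k q') ->
  mcoeff m (p * q) = mcoeff m (p' * q').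
Proof.
move=> pp qq; rewrite !(@mcoeff_poly_mul_lin _ _ _ _ m (mdeg m).+1)//.
apply: eq_bigr => k km; rewrite pp ?qq//; last by rewrite -ltnS bmdeg.
exact: mdegB.
Qed.

Lemma fps_mulE N f g m : (mdeg m < N)%N ->
  fps_mul f g m = mcoeff m (fps_trunc N f * fps_trunc N g).
Proof.
move=> mN; rewrite (@mcoeff_poly_mul_lin _ _ _ _ m (mdeg m).+1)//.
apply: eq_bigr => k km; rewrite !mcoeff_fps_trunc.
rewrite (leq_trans (bmdeg k))// (leq_ltn_trans (mdegB _ _))//.
Qed.

Lemma fps_mulA : associative fps_mul.
Proof.
move=> f g h; apply/funext => m; pose N := (mdeg m).+1.
have lN k : (mdeg k <= mdeg m)%N -> (mdeg k < N)%N by rewrite ltnS.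
rewrite !(@fps_mulE N)//.
transitivity (mcoeff m (fps_trunc N f * (fps_trunc N g * fps_trunc N h))).
  by apply: eq_mcoeffM => // k /lN kN; rewrite mcoeff_fps_trunc kN (@fps_mulE N).
rewrite mulrA; apply: eq_mcoeffM => // k /lN kN.
by rewrite mcoeff_fps_trunc kN (@fps_mulE N).
Qed.

Lemma fps_mulC : commutative fps_mul.
Proof.
by move=> f g; apply/funext => m; rewrite !(@fps_mulE (mdeg m).+1)// mulrC.
Qed.

Lemma fps_mul1 : left_id fps_one fps_mul.
Proof.
move=> f; apply/funext => m; rewrite (@fps_mulE (mdeg m).+1)//.
transitivity (mcoeff m (1 * fps_trunc (mdeg m).+1 f)).
  by apply: eq_mcoeffM => // k km; rewrite mcoeff_fps_trunc ltnS km mcoeff1.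
by rewrite mul1r mcoeff_fps_trunc ltnSn.
Qed.

Lemma fps_mulDl : left_distributive fps_mul +%R.
Proof.
move=> f g h; apply/funext => m; rewrite fps_addE /fps_mul -big_split.
by apply: eq_bigr => k _; rewrite fps_addE mulrDl.
Qed.

Lemma fps_one_neq0 : fps_one != 0.
Proof.
apply/eqP => /(congr1 (fun f : fps => f mnm0)); rewrite /fps_one eqxx.
by move/eqP; rewrite oner_eq0.
Qed.

HB.instance Definition _ := GRing.Zmodule_isComNzRing.Build fps
  fps_mulA fps_mulC fps_mul1 fps_mulDl fps_one_neq0.


Lemma mul_fpsE (f g : fps) m : (f * g) m = fps_mul f g m.
Proof. by []. Qed.

(* bmultinom n N is the finite type of the exponents of total degree < N. *)
Definition psum (N : nat) (a : fps) : R := \sum_(m : bmultinom n N) a m.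

Lemma psumD N (a b : fps) : psum N (a + b) = psum N a + psum N b.
Proof. by rewrite /psum -big_split. Qed.

Lemma psumN N (a : fps) : psum N (- a) = - psum N a.
Proof. by rewrite /psum -sumrN. Qed.

Definition fps_abs (a : fps) : fps := fun m => `|a m|.

Lemma psum_mul N (a b : fps) : psum N (fps_mul a b) =
  \sum_(k : bmultinom n N * bmultinom n N | (mdeg (mnm_add k.1 k.2) < N)%N)
     a k.1 * b k.2.
Proof.
rewrite /psum.
transitivity (\sum_(m : bmultinom n N)
    \sum_(k : bmultinom n N * bmultinom n N | bmnm m == mnm_add k.1 k.2)
       a k.1 * b k.2).
  apply: eq_bigr => m _; rewrite (@fps_mulE N) ?bmdeg//.
  rewrite (@mcoeff_poly_mul _ _ _ _ m N) ?bmdeg//.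
  by apply: eq_bigr => k _; rewrite !mcoeff_fps_trunc !bmdeg.
rewrite (exchange_big_dep predT)//= [RHS]big_mkcond/=.
apply: eq_bigr => k _; case: ifP => kN.
  by rewrite (big_pred1 (BMultinom kN)).
rewrite big_pred0// => m; apply/negbTE/eqP => mk.
by have := bmdeg m; rewrite mk kN.
Qed.

Lemma psum_prod N (a b : fps) : psum N a * psum N b =
  \sum_(k : bmultinom n N * bmultinom n N) a k.1 * b k.2.
Proof. by rewrite /psum big_distrlr pair_big. Qed.

Definition fps_cut (N : nat) (a : fps) : fps :=
  fun m => if (mdeg m < N)%N then a m else 0.

Lemma psum_cut N M a : (N <= M)%N -> psum M (fps_cut N a) = psum N a.
Proof.
move=> NM; rewrite /psum /fps_cut -big_mkcond /=; apply/esym.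
exact: (ssrcomplements.big_sub_widen (bmultinom n N) (bmultinom n M) predT a
  (fun m h => leq_trans h NM)).
Qed.

Lemma psum_ge0 N (a : fps) : (forall m, 0 <= a m) -> 0 <= psum N a.
Proof. by move=> a0; apply: sumr_ge0. Qed.

Lemma le_psum N (a b : fps) : (forall m, a m <= b m) -> psum N a <= psum N b.
Proof. by move=> ab; apply: ler_sum. Qed.

Lemma ler_norm_psum N (a : fps) : `|psum N a| <= psum N (fps_abs a).
Proof. exact: ler_norm_sum. Qed.

Lemma psum_nd (a : fps) : (forall m, 0 <= a m) ->
  nondecreasing_seq (fun N => psum N a).
Proof.
move=> a0 N M NM; rewrite -(psum_cut a NM); apply: le_psum => m.
by rewrite /fps_cut; case: ifP.
Qed.

Lemma fps_mul_ge0 (a b : fps) : (forall m, 0 <= a m) -> (forall m, 0 <= b m) ->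
  forall m, 0 <= fps_mul a b m.
Proof. by move=> a0 b0 m; apply: sumr_ge0 => k _; apply: mulr_ge0. Qed.

Lemma psum_mul_le N (a b : fps) : (forall m, 0 <= a m) -> (forall m, 0 <= b m) ->
  psum N (fps_mul a b) <= psum N a * psum N b.
Proof.
move=> a0 b0; rewrite psum_mul psum_prod big_mkcond; apply: ler_sum => k _.
by case: ifP => // _; apply: mulr_ge0.
Qed.

Lemma psum_mul_ge N (a b : fps) : (forall m, 0 <= a m) -> (forall m, 0 <= b m) ->
  psum N a * psum N b <= psum (N + N) (fps_mul a b).
Proof.
move=> a0 b0; have NM : (N <= N + N)%N by rewrite leq_addr.
rewrite -(psum_cut a NM) -(psum_cut b NM) psum_prod psum_mul.
rewrite [leRHS]big_mkcond; apply: ler_sum => k _.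
rewrite /fps_cut; case: ifP => aN; last first.
  by rewrite mul0r; case: ifP => // _; apply: mulr_ge0.
case: ifP => bN; last first.
  by rewrite mulr0; case: ifP => // _; apply: mulr_ge0.
by rewrite ifT// mdegD -addSn leq_add// ltnW.
Qed.

Lemma psum_mul_dist N (a b : fps) :
  `|psum N a * psum N b - psum N (fps_mul a b)| <=
  psum N (fps_abs a) * psum N (fps_abs b)
  - psum N (fps_mul (fps_abs a) (fps_abs b)).
Proof.
rewrite !psum_prod !psum_mul.
rewrite [X in X - _](bigID (fun k : bmultinom n N * bmultinom n N =>
  (mdeg (mnm_add k.1 k.2) < N)%N))/= addrAC subrr add0r.
rewrite [X in _ <= X - _](bigID (fun k : bmultinom n N * bmultinom n N =>
  (mdeg (mnm_add k.1 k.2) < N)%N))/= addrAC subrr add0r.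
apply: le_trans (ler_norm_sum _ _ _) _.
by apply: ler_sum => k _; rewrite normrM.
Qed.

Definition fps_bounded (a : fps) := exists C, forall N, psum N (fps_abs a) <= C.

Lemma fps_abs_ge0 a m : 0 <= fps_abs a m. Proof. exact: normr_ge0. Qed.
Hint Resolve fps_abs_ge0 : core.

Lemma nd_psum_cvg (a : fps) C : (forall m, 0 <= a m) ->
  (forall N, psum N a <= C) -> cvgn (fun N => psum N a).
Proof.
move=> a0 aC; apply: nondecreasing_is_cvgn; first exact: psum_nd.
by exists C => _ [N _ <-].
Qed.

Lemma fps_bounded_cvg_abs a : fps_bounded a ->
  cvgn (fun N => psum N (fps_abs a)).
Proof. by case=> C aC; apply: (@nd_psum_cvg _ C). Qed.

Lemma fps_bounded_cvg a : fps_bounded a -> cvgn (fun N => psum N a).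
Proof.
move=> ba; have ca := fps_bounded_cvg_abs ba; case: (ba) => C aC.
rewrite (_ : (fun N => psum N a) = (fun N => psum N (a + fps_abs a))
    - (fun N => psum N (fps_abs a))); last first.
  by apply/funext => N; rewrite !fctE psumD addrK.
apply: is_cvgB => //; apply: (@nd_psum_cvg _ (C + C)) => [m|N].
  by rewrite fps_addE /fps_abs -lerBlDl sub0r -normrN ler_norm.
rewrite psumD lerD//; apply: le_trans (aC N).
by apply: le_trans (ler_norm _) (ler_norm_psum _ _).
Qed.

Lemma fps_boundedD a b : fps_bounded a -> fps_bounded b -> fps_bounded (a + b).
Proof.
move=> [C aC] [D bD]; exists (C + D) => N; apply: le_trans (lerD (aC N) (bD N)).
by rewrite -psumD; apply: le_psum => m; apply: ler_normD.
Qed.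

Lemma fps_boundedN a : fps_bounded a -> fps_bounded (- a).
Proof.
move=> [C aC]; exists C => N; apply: le_trans (aC N).
by apply: le_psum => m; rewrite /fps_abs normrN.
Qed.

Lemma fps_boundedM a b : fps_bounded a -> fps_bounded b ->
  fps_bounded (fps_mul a b).
Proof.
move=> [C aC] [D bD]; exists (C * D) => N.
apply: (@le_trans _ _ (psum N (fps_mul (fps_abs a) (fps_abs b)))).
  apply: le_psum => m; apply: le_trans (ler_norm_sum _ _ _) _.
  by apply: ler_sum => k _; rewrite normrM.
apply: le_trans (psum_mul_le _ _ _) _ => //.
by apply: ler_pM => //; apply: psum_ge0.
Qed.

Lemma lim_psumM a b : fps_bounded a -> fps_bounded b ->
  limn (fun N => psum N (fps_mul a b)) =
  limn (fun N => psum N a) * limn (fun N => psum N b).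
Proof.
move=> ba bb; have bab := fps_boundedM ba bb.
have ca := fps_bounded_cvg ba; have cb := fps_bounded_cvg bb.
have cA := fps_bounded_cvg_abs ba; have cB := fps_bounded_cvg_abs bb.
set A := limn (fun N => psum N (fps_abs a)) in cA.
set B := limn (fun N => psum N (fps_abs b)) in cB.
have AB0 := fps_mul_ge0 (fps_abs_ge0 a) (fps_abs_ge0 b).
have cAB : cvgn (fun N => psum N (fps_mul (fps_abs a) (fps_abs b))).
  have [C aC] := ba; have [D bD] := bb.
  apply: (@nd_psum_cvg _ (C * D)) => // N.
  apply: le_trans (psum_mul_le _ _ _) _ => //.
  by apply: ler_pM => //; apply: psum_ge0.
set L := limn (fun N => psum N (fps_mul (fps_abs a) (fps_abs b))) in cAB.
have LE : L = A * B.
  apply/eqP; rewrite eq_le; apply/andP; split.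
    rewrite /L /A /B -limM//; apply: ler_lim => //; first exact: is_cvgM.
    by near=> N; apply: psum_mul_le.
  rewrite /A /B -limM//; apply: limr_le; first exact: is_cvgM.
  near=> N; apply: le_trans (psum_mul_ge _ _ _) _ => //.
  by apply: nondecreasing_cvgn_le => //; apply: psum_nd.
apply/eqP; rewrite -subr_eq0 -limM// -limB//; last 2 first.
- exact: fps_bounded_cvg.
- exact: is_cvgM.
apply/eqP/cvg_lim => //; apply: norm_cvg0.
apply: (@squeeze_cvgr _ _ _ _ (cst 0)
  (fun N => psum N (fps_abs a) * psum N (fps_abs b)
  - psum N (fps_mul (fps_abs a) (fps_abs b)))).
- near=> N; rewrite normr_ge0/= distrC.
  exact: psum_mul_dist.
- exact: cvg_cst.
- rewrite -(subrr L) {1}LE; apply: cvgB; last exact: cAB.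
  by apply: cvgM; [exact: cA|exact: cB].
Unshelve. all: by end_near. Qed.

Lemma summable_fps (a : fps) :
  summable [set: multinom n] (fun m => (a m)%:E) <-> fps_bounded a.
Proof.
have sumE N : (psum N (fps_abs a))%:E =
    (\sum_(m \in [set` map val (enum {: bmultinom n N})]) `|(a m)%:E|)%E.
  rewrite -fsbig_seq//; last first.
    by rewrite map_inj_uniq ?enum_uniq//; exact: val_inj.
  by rewrite big_map big_enum sumEFin.
split => [sa|[C aC]].
  pose E := (\esum_(m in [set: multinom n]) `|(a m)%:E|)%E.
  have Efin : E \is a fin_num by rewrite -summableE.
  exists (fine E) => N; rewrite -lee_fin fineK// sumE.
  apply: esum_ge; exists [set` map val (enum {: bmultinom n N})] => //.
  by split=> //; exact: finite_seq.
rewrite /summable (@le_lt_trans _ _ C%:E)// ?ltry//.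
apply: ge_ereal_sup => _ [S [finS _] <-].
have [N SN] : exists N, forall m, S m -> (mdeg m < N)%N.
  exists (\max_(m <- fset_set S) mdeg m).+1 => m Sm; rewrite ltnS.
  by apply: (@leq_bigmax_seq _ _ predT mdeg) => //; rewrite in_fset_set// mem_set.
apply: le_trans (_ : (psum N (fps_abs a))%:E <= _)%E; last by rewrite lee_fin.
rewrite sumE; apply: lee_fsum_nneg_subset => //; first exact: finite_seq.
move=> m /set_mem /SN mN; apply/mem_set => /=; apply/mapP.
by exists (BMultinom mN); rewrite ?mem_enum.
Qed.

Definition fps_term (f : fps) (x : 'rV[R]_n) : fps :=
  fun m => f m * \prod_(i < n) x 0 i ^+ m i.

(* A power series in several variables has no preferred order of summation:
   convergence at a point is absolute. *)
Definition abs_converges (f : fps) (x : 'rV[R]_n) : Prop :=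
  summable [set: multinom n] (fun m => (fps_term f x m)%:E).

(* Where f converges absolutely at x, this is the sum of the series whatever
   the order of summation. *)
Definition fps_sum (f : fps) (x : 'rV[R]_n) : R :=
  limn (fun N => psum N (fps_term f x)).

Definition convergent (f : fps) : Prop :=
  \forall x \near (0 : 'rV[R]_n), abs_converges f x.

Lemma fps_termD f g x : fps_term (f + g) x = fps_term f x + fps_term g x.
Proof. by apply/funext => m; rewrite fps_addE /fps_term fps_addE mulrDl. Qed.

Lemma fps_termN f x : fps_term (- f) x = - fps_term f x.
Proof. by apply/funext => m; rewrite /fps_term mulNr. Qed.

Lemma fps_termM f g x :
  fps_term (f * g) x = fps_mul (fps_term f x) (fps_term g x).
Proof.
apply/funext => m; rewrite /fps_term mul_fpsE /fps_mul mulr_suml.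
apply: eq_bigr => k km; rewrite mulrACA; congr (_ * _).
rewrite -big_split; apply: eq_bigr => i _ /=.
by rewrite -exprD mnmBE subnKC//; apply: (mnm_lepP km).
Qed.

Lemma psum_one N x : psum N.+1 (fps_term 1 x) = 1.
Proof.
have lt0 : (mdeg (@mnm0 n) < N.+1)%N by rewrite mdeg0.
rewrite /psum (bigD1 (BMultinom lt0))//= big1 ?addr0 => [|m m0].
  rewrite /fps_term [X in X * _]/GRing.one /= /fps_one eqxx mul1r big1// => i _.
  by rewrite mnm0E expr0.
rewrite /fps_term [X in X * _]/GRing.one /= /fps_one.
by move: m0; rewrite bmeqP /= => /negbTE ->; rewrite mul0r.
Qed.

Lemma abs_convergesD f g x : abs_converges f x -> abs_converges g x ->
  abs_converges (f + g) x.
Proof.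
move=> /summable_fps cf /summable_fps cg; apply/summable_fps.
by rewrite fps_termD; exact: fps_boundedD.
Qed.

Lemma abs_convergesN f x : abs_converges f x -> abs_converges (- f) x.
Proof.
move=> /summable_fps cf; apply/summable_fps.
by rewrite fps_termN; exact: fps_boundedN.
Qed.

Lemma abs_convergesM f g x : abs_converges f x -> abs_converges g x ->
  abs_converges (f * g) x.
Proof.
move=> /summable_fps cf /summable_fps cg; apply/summable_fps.
by rewrite fps_termM; exact: fps_boundedM.
Qed.

Lemma abs_converges0 x : abs_converges 0 x.
Proof.
apply/summable_fps; exists 0 => N; rewrite /psum big1// => m _.
by rewrite /fps_abs /fps_term mul0r normr0.
Qed.

Lemma abs_converges1 x : abs_converges 1 x.
Proof.
apply/summable_fps; exists 1 => N.
rewrite (le_trans (psum_nd (fps_abs_ge0 _) (leqnSn N)))//.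
have -> : fps_abs (fps_term 1 x) = fps_term 1 x; last by rewrite psum_one.
apply/funext => m; rewrite /fps_abs /fps_term.
rewrite [X in X * _]/GRing.one /= /fps_one; case: eqP => [->|_]; last first.
  by rewrite mul0r normr0.
by rewrite big1 ?mulr1 ?normr1// => i _; rewrite mnm0E expr0.
Qed.

Lemma fps_sumD f g x : abs_converges f x -> abs_converges g x ->
  fps_sum (f + g) x = fps_sum f x + fps_sum g x.
Proof.
move=> /summable_fps/fps_bounded_cvg cf /summable_fps/fps_bounded_cvg cg.
rewrite /fps_sum -limD//; congr (limn _); apply/funext => N.
by rewrite fps_termD psumD.
Qed.

Lemma fps_sumM f g x : abs_converges f x -> abs_converges g x ->
  fps_sum (f * g) x = fps_sum f x * fps_sum g x.
Proof.
move=> /summable_fps cf /summable_fps cg.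
by rewrite /fps_sum fps_termM lim_psumM.
Qed.

Lemma fps_sum0 x : fps_sum 0 x = 0.
Proof.
rewrite /fps_sum (_ : (fun _ => _) = cst 0) ?lim_cst//.
by apply/funext => N; apply: big1 => m _; rewrite /fps_term mul0r.
Qed.

Lemma fps_sum1 x : fps_sum 1 x = 1.
Proof.
apply: cvg_lim => //; rewrite -(cvg_shiftS _ _).
by rewrite (_ : (fun _ => _) = cst 1);
  [exact: cvg_cst|apply/funext => N; exact: psum_one].
Qed.

Definition convergent_pred : {pred fps} := [pred f | `[< convergent f >]].

Lemma convergent_subring : subring_closed convergent_pred.
Proof.
split=> [|f g|f g]; rewrite !inE.
- by apply/asboolP; rewrite /convergent; near=> x; exact: abs_converges1.
- move=> /asboolP cf /asboolP cg; apply/asboolP; near=> x.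
  by apply: abs_convergesD; [near: x|apply: abs_convergesN; near: x].
- move=> /asboolP cf /asboolP cg; apply/asboolP; near=> x.
  by apply: abs_convergesM; near: x.
Unshelve. all: by end_near. Qed.

HB.instance Definition _ :=
  GRing.isSubringClosed.Build fps convergent_pred convergent_subring.

Record cps := Cps { fps_of_cps :> fps; _ : fps_of_cps \in convergent_pred }.

HB.instance Definition _ := [isSub for fps_of_cps].
HB.instance Definition _ := [Choice of cps by <:].
HB.instance Definition _ := [SubChoice_isSubComNzRing of cps by <:].

End FormalPowerSeries.

Section AnalyticGeometry.
Variables (R : realType) (n : nat).
Implicit Types (X U V M : set 'rV[R]_n) (p : 'rV[R]_n).

Definition real_zero_set (I : set (mpoly n R)) : set 'rV[R]_n :=
  [set x | forall f, I f -> meval (x 0) f = 0].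

Definition origin_ideal : set (mpoly n R) :=
  ideal_span (range (fun i : 'I_n => mpolyX R (mnm1 i))).

Lemma real_zero_set_origin (I : set (mpoly n R)) :
  I `<=` origin_ideal -> real_zero_set I 0.
Proof.
move=> IM f /IM; apply: (_ : origin_ideal `<=` [set f | meval (_ 0) f = 0]).
apply: smallest_sub => [|_ [i _ <-]] /=.
  split=> [|g h|a g] /=; first exact: meval0.
    by rewrite mevalD => -> ->; rewrite addr0.
  by rewrite mevalM => ->; rewrite mulr0.
by rewrite mevalXU mxE.
Qed.

Definition vanishes_near_origin X (f : fps R n) : Prop :=
  \forall x \near (0 : 'rV[R]_n),
    abs_converges f x /\ (X x -> fps_sum f x = 0).

(* The proof of X 0 does not occur in the body: it makes the ideal proper, as
   {ideal_quot _} requires. *)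
Definition germ_ideal X of X 0 : {pred cps R n} :=
  [pred f : cps R n | `[< vanishes_near_origin X f >]].

Lemma cps_convergent (f : cps R n) : convergent f.
Proof. by case: f => f /= /asboolP. Qed.

Lemma germ_ideal_closed X (X0 : X 0) : idealr_closed (germ_ideal X0).
Proof.
split=> [||a f g]; rewrite !inE.
- apply/asboolP; rewrite /vanishes_near_origin; near=> x.
  by split; [exact: abs_converges0|rewrite fps_sum0].
- apply/asboolP => /nbhs_singleton[_ /(_ X0)] /eqP.
  by rewrite fps_sum1 oner_eq0.
- move=> /asboolP cf /asboolP cg; apply/asboolP; near=> x.
  have [cfx fx] : abs_converges f x /\ (X x -> fps_sum f x = 0) by near: x.
  have [cgx gx] : abs_converges g x /\ (X x -> fps_sum g x = 0) by near: x.
  have cax : abs_converges a x by near: x; exact: cps_convergent.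
  have cafx : abs_converges (val a * val f) x by exact: abs_convergesM.
  split=> [|Xx]; first exact: abs_convergesD.
  by rewrite [LHS]fps_sumD// fps_sumM// fx// gx// mulr0 addr0.
Unshelve. all: by end_near. Qed.

HB.instance Definition _ X (X0 : X 0) :=
  isIdealr.Build (cps R n) (germ_ideal X0) (germ_ideal_closed X0).

Definition germ_ring X (X0 : X 0) : comNzRingType :=
  {ideal_quot (germ_ideal X0)}.

Definition analytic_at (f : 'rV[R]_n -> R) p : Prop :=
  exists s : cps R n, \forall h \near (0 : 'rV[R]_n), f (p + h) = fps_sum s h.

Definition analytic_map U (phi : 'rV[R]_n -> 'rV[R]_n) : Prop :=
  forall p, U p -> forall j, analytic_at (fun x => phi x 0 j) p.

Definition analytic_diffeo U V (phi : 'rV[R]_n -> 'rV[R]_n) : Prop :=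
  set_bij U V phi /\
  exists psi : 'rV[R]_n -> 'rV[R]_n,
    [/\ (forall x, U x -> psi (phi x) = x),
        analytic_map U phi & analytic_map V psi].

(* Coordinates are numbered from 0, so the equations are those of index >= d. *)
Definition analytic_submanifold (d : nat) M : Prop :=
  forall p, M p -> exists U V phi,
    [/\ open U /\ U p, open V, analytic_diffeo U V phi
      & M `&` U = [set x | U x /\ forall i : 'I_n, (d <= i)%N -> phi x 0 i = 0]].

Definition manifold_point X p : Prop :=
  X p /\ exists U, [/\ open U, U p
    & exists2 d, (d <= n)%N & analytic_submanifold d (X `&` U)].

End AnalyticGeometry.

(* Main.v *)
(* Fix the degree-lexicographic order on exponents, let K be the ideal of germs
   vanishing on X, and call x_j a pivot when it is the initial monomial of an
   element of K. Grauert's division by K (a convergent division with remainder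
   along a standard basis) writes each pivot as x_j = G_j modulo K, where G_j is a
   convergent series in the remaining, free variables. Both sides of the
   equivalence amount to the condition that no nonzero element of K involves free
   variables only.

   Regularity. The maximal ideal needs at least as many generators as there are
   free variables. If P_0 < ... < P_s is a chain of primes above K and x_i lies in
   P_(i+1) but not in P_i, then by Artin-Rees (which also comes from division) the
   k^s monomials in the x_i with exponents below k are independent modulo
   P_0 + m^N with N linear in k, so k^s is at most the number of monomials of
   degree < N that are not initial monomials of K. This bounds the dimension by
   the number e of free variables, and by e - 1 when K contains a nonzero series
   in the free variables. Conversely, if there is no such series the quotient is
   the ring of convergent series in the free variables.

   Manifold points. If there is no such series, then F(G) = 0 for every F in I,
   since F(G) is in K; so X is the graph of G near 0, for a radius that does not
   depend on F. Conversely, a chart at 0 yields, for every value w of the free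
   variables, a curve in X tangent to a vector with free coordinates w; hence the
   lowest homogeneous part of a series of K in the free variables vanishes at w. *)

Require Import Defs.
From mathcomp Require Import all_boot all_order all_algebra.
From mathcomp Require Import all_classical all_reals.
From mathcomp Require Import topology normedtype sequences.
From mathcomp Require Import ring lra zify.
From mathcomp Require mpoly.
Import -(notations) mpoly.

Set Implicit Arguments.
Unset Strict Implicit.
Unset Printing Implicit Defensive.

Import Order.TTheory GRing.Theory Num.Theory.
Import numFieldNormedType.Exports.
Local Open Scope classical_set_scope.
Local Open Scope ring_scope.

(** * Exponents and formal series *)

Section Dickson.

(** Each index is chosen where [u] is minimal among all indices beyond the previous choice, so no
    later value can be smaller. *)
Lemma nat_nondecreasing_subseq (u : nat -> nat) :
  exists2 phi : nat -> nat, {homo phi : i j / (i < j)%N} &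
    {homo u \o phi : i j / (i <= j)%N}.
Proof.
have minu N : exists k, (N <= k)%N /\ forall j, (N <= j)%N -> (u k <= u j)%N.
  have ex : exists v, `[< exists2 k, (N <= k)%N & u k = v >].
    by exists (u N); apply/asboolP; exists N.
  case: (ex_minnP ex) => v /asboolP[k Nk <-] vmin.
  exists k; split=> // j Nj; apply: vmin; apply/asboolP; by exists j.
have [mu muP] := choice minu.
pose phi := fix phi i := if i is j.+1 then mu (phi j).+1 else mu 0.
have phiS i : (phi i < phi i.+1)%N by have [] := muP (phi i).+1.
have phimono : {homo phi : i j / (i < j)%N}.
  by apply: homo_ltn => //; exact: ltn_trans.
exists phi => //; apply: homo_leq => // [|i] /=; first exact: leq_trans.
case: i => [|i].
  by have [_ h] := muP 0; apply: h.
by have [_ h] := muP (phi i).+1; apply: h; apply: ltn_trans (phiS _) (phiS _).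
Qed.

(** The subsequence is refined once per coordinate: passing to a further subsequence preserves the
    monotonicity already obtained. *)
Lemma multinom_nondecreasing_pair (n : nat) (u : nat -> multinom n) :
  exists i j, (i < j)%N /\ lem (u i) (u j).
Proof.
have sub (s : seq 'I_n) : exists2 phi : nat -> nat,
    {homo phi : i j / (i < j)%N} &
    forall k, k \in s -> {homo (fun i => u (phi i) k) : i j / (i <= j)%N}.
  elim: s => [|k s [phi phiS phi_s]]; first by exists id.
  have [psi psiS psi_k] := nat_nondecreasing_subseq (fun i => u (phi i) k).
  have psi_le : {homo psi : i j / (i <= j)%N}.
    by apply: ltnW_homo.
  exists (phi \o psi) => [i j ij|l]; first by apply/phiS/psiS.
  by rewrite inE => /predU1P[-> //|ls] i j ij; apply/(phi_s _ ls)/psi_le.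
have [phi phiS phi_n] := sub (enum 'I_n).
exists (phi 0), (phi 1); split; first exact: phiS.
by apply/mnm_lepP => k; apply: (phi_n k (mem_enum _ _) 0 1).
Qed.

(** If no finite part of [E] dominated it, one could choose forever elements of [E] lying above none
    of the earlier choices, against [multinom_nondecreasing_pair]. *)
Lemma dickson (n : nat) (E : set (multinom n)) :
  exists s : seq (multinom n), (forall a, a \in s -> E a) /\
    forall b, E b -> exists2 a, a \in s & lem a b.
Proof.
apply: contrapT => nE.
have next (s : seq (multinom n)) : exists b, (forall a, a \in s -> E a) ->
    E b /\ forall a, a \in s -> ~~ lem a b.
  have [sE|/existsNP[a /not_implyP[sa Ea]]] := pselect (forall a, a \in s -> E a).
    apply: contrapT => nb; apply: nE; exists s; split=> // b Eb.
    apply: contrapT => nab; apply: nb; exists b => _; split=> // a sa.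
    by apply/negP => ab; apply: nab; exists a.
  by exists mnm0 => /(_ _ sa).
have [nxt nxtP] := choice next.
pose v := fix v i := if i is j.+1 then nxt (v j) :: v j else [::].
have vE i : forall a, a \in v i -> E a.
  elim: i => [//|i IH] a /=; rewrite inE => /predU1P[->|/IH //].
  by have [] := nxtP _ IH.
have vin i j : (i < j)%N -> nxt (v i) \in v j.
  elim: j => [//|j IH]; rewrite ltnS leq_eqVlt => /predU1P[->|/IH].
    by rewrite /= inE eqxx.
  by rewrite /= inE orbC => ->.
have [i [j [ij]]] := multinom_nondecreasing_pair (fun i => nxt (v i)).
have [_ /(_ _ (vin _ _ ij))] := nxtP _ (vE j).
by move=> /negbTE ->.
Qed.

End Dickson.

(** * Formal power series: orders and initial exponents *)

Section FormalSeries.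
Variables (R : realType) (n : nat).
Implicit Types (f g : fps R n) (a b m : multinom n) (c : R).

Lemma fpsD f g m : (f + g) m = f m + g m. Proof. by []. Qed.
Lemma fpsB f g m : (f - g) m = f m - g m. Proof. by []. Qed.
Lemma fps0 m : (0 : fps R n) m = 0. Proof. by []. Qed.

Lemma fps1 m : (1 : fps R n) m = (m == mnm0)%:R. Proof. by []. Qed.

Lemma fps_sumE (T : Type) (r : seq T) (P : pred T) (F : T -> fps R n) m :
  (\sum_(i <- r | P i) F i) m = \sum_(i <- r | P i) F i m.
Proof. by elim/big_rec2: _ => // i x y _ <-. Qed.

Lemma fpsM f g m : (f * g) m =
  \sum_(k : bmultinom n (mdeg m).+1 | lem k m) f k * g (mnm_sub m k).
Proof. by []. Qed.

Definition fpsC c : fps R n := fun m => if m == mnm0 then c else 0.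
Definition fpsX a : fps R n := fun m => (m == a)%:R.

Lemma fpsXM a f m : (fpsX a * f) m = if lem a m then f (mnm_sub m a) else 0.
Proof.
rewrite fpsM; case: ifP => am; last first.
  apply: big1 => k km; rewrite /fpsX; case: eqP => [ka|]; last by rewrite mul0r.
  by rewrite ka am in km.
have ad : (mdeg a < (mdeg m).+1)%N by rewrite ltnS lemc_mdeg// lem_leo.
rewrite (bigD1 (BMultinom ad))//= /fpsX eqxx mul1r big1 ?addr0//.
by move=> k /andP[_]; rewrite bmeqP /= => /negbTE ->; rewrite mul0r.
Qed.

Lemma fpsCM c f m : (fpsC c * f) m = c * f m.
Proof.
have -> : fpsC c = [the fps R n of (fun k => c * fpsX mnm0 k)].
  by apply/funext => k; rewrite /fpsC /fpsX /=; case: eqP; rewrite (mulr1,mulr0).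
transitivity (c * (fpsX mnm0 * f) m).
  by rewrite !fpsM mulr_sumr; apply: eq_bigr => k _; rewrite mulrA.
rewrite fpsXM (_ : lem _ _); last by apply/mnm_lepP => i; rewrite mnm0E.
by rewrite subm0.
Qed.

(** This is membership in the [N]-th power of the maximal ideal, expressed on coefficients. *)
Definition ordge (N : nat) f := forall m, (mdeg m < N)%N -> f m = 0.

Lemma ordge0 f : ordge 0 f. Proof. by []. Qed.

Lemma ordgeW N M f : (M <= N)%N -> ordge N f -> ordge M f.
Proof. by move=> MN fN m mM; apply: fN; apply: leq_trans MN. Qed.

Lemma ordgeM N M f g : ordge N f -> ordge M g -> ordge (N + M) (f * g).
Proof.
move=> fN gM m mNM; rewrite fpsM big1 // => k km.
have [kN|Nk] := ltnP (mdeg k) N; first by rewrite fN ?mul0r.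
rewrite gM ?mulr0//; have := congr1 (@mdeg n) (submK km).
rewrite mdegD => dE; rewrite -(ltn_add2r (mdeg k)) dE.
by apply: leq_trans mNM _; rewrite addnC leq_add2l.
Qed.

Lemma ordge_sum N (T : Type) (r : seq T) (P : pred T) (F : T -> fps R n) :
  (forall i, P i -> ordge N (F i)) -> ordge N (\sum_(i <- r | P i) F i).
Proof.
by move=> FN m mN; rewrite fps_sumE big1// => i /FN; apply.
Qed.

(** The initial exponent is the lowest one, as for a local order; the order on exponents is
    well-founded, so every nonzero series has one. *)
Definition initial f a := f a != 0 /\ forall b, (b < a)%O -> f b = 0.

Lemma initial_exists f : f != 0 -> exists a, initial f a.
Proof.
move=> f0; apply: contrapT => nf; move/eqP: f0; apply; apply/funext.
elim/(@ltmwf n) => m IH; apply/eqP; apply: contrapT => /negP fm.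
by apply: nf; exists m.
Qed.

Lemma coef0M f g : (f * g) mnm0 = f mnm0 * g mnm0.
Proof.
rewrite fpsM (big_pred1 (@bm0 n (mdeg (@mnm0 n)))) => [|k]; first by rewrite /= subm0.
rewrite /= bmeqP /=; apply/idP/eqP => [k0|->]; last exact/mnm_lepP.
by apply/mnmP => i; have /mnm_lepP/(_ i) := k0; rewrite mnm0E leqn0 => /eqP ->.
Qed.

(** Exponents at least [a] and at least [b] whose sum is at most [a + b] must equal [a] and [b].
    Hence up to [a + b] only the product of the two initial terms contributes. *)
Lemma initialM f g a b :
  initial f a -> initial g b -> initial (f * g) (mnm_add a b).
Proof.
move=> [fa fl] [gb gl].
have key m (k : multinom n) : (m <= mnm_add a b)%O -> lem k m ->
    f k * g (mnm_sub m k) != 0 -> k = a /\ mnm_sub m k = b.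
  move=> mab km; rewrite mulf_eq0 negb_or => /andP[fk gk].
  have ak : (a <= k)%O by rewrite leNgt; apply/negP => /fl /eqP; exact/negP.
  have bk : (b <= mnm_sub m k)%O.
    by rewrite leNgt; apply/negP => /gl /eqP; exact/negP.
  have mE := submK km; rewrite addmC in mE.
  have mab' : m = mnm_add a b.
    by apply/le_anti; rewrite mab /= -[X in (_ <= X)%O]mE lem_add.
  have /negbTE ka : ~~ (a < k)%O.
    by apply/negP => ak'; have := ltmc_le_add ak' bk; rewrite mE mab' ltxx.
  have kE : k = a by apply/le_anti; rewrite ak andbT leNgt ka.
  by split=> //; rewrite kE mab' addmC addmK.
split=> [|m mab].
  have ad : (mdeg a < (mdeg (mnm_add a b)).+1)%N by rewrite ltnS mdegD leq_addr.
  have abK : mnm_sub (mnm_add a b) a = b by rewrite addmC addmK.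
  rewrite fpsM (bigD1 (BMultinom ad)) /= ?lem_addr// abK big1 ?addr0.
    by rewrite mulf_neq0.
  move=> k /andP[kab]; rewrite bmeqP /= => ka; apply/eqP; apply: contrapT => /negP nz.
  by have [kE _] := key _ _ (lexx _) kab nz; rewrite kE eqxx in ka.
rewrite fpsM big1// => k km; apply/eqP; apply: contrapT => /negP nz.
have [ka kb] := key _ _ (ltW mab) km nz.
by move: mab; rewrite -(submK km) kb ka addmC ltxx.
Qed.

Lemma fps_mulf_eq0 f g : f * g = 0 -> f = 0 \/ g = 0.
Proof.
move=> fg; have [->|/initial_exists[a fa]] := eqVneq f 0; first by left.
have [->|/initial_exists[b gb]] := eqVneq g 0; first by right.
by have [] := initialM fa gb; rewrite fg eqxx.
Qed.

End FormalSeries.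

Notation coef f m := (fps_of_cps f m).

(** * Convergent series *)

Section Convergence.
Variables (R : realType) (n : nat).
Implicit Types (f g : fps R n) (x y : 'rV[R]_n) (a b m : multinom n).

Definition mon x m : R := \prod_(i < n) x 0 i ^+ m i.

Lemma monD x a b : mon x (mnm_add a b) = mon x a * mon x b.
Proof. by rewrite /mon -big_split; apply: eq_bigr => i _ /=; rewrite mnmDE exprD. Qed.

Lemma mon0 x : mon x mnm0 = 1.
Proof. by rewrite /mon big1// => i _; rewrite mnm0E expr0. Qed.

Lemma mon1 x i : mon x (mnm1 i) = x 0 i.
Proof.
rewrite /mon (bigD1 i)//= mnm1E eqxx expr1 big1 ?mulr1// => j ji.
by rewrite mnm1E eq_sym (negbTE ji) expr0.
Qed.

Lemma mon_gt0 x m : (forall i, 0 < x 0 i) -> 0 < mon x m.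
Proof. by move=> x0; apply: prodr_gt0 => i _; rewrite exprn_gt0. Qed.

Lemma mon_const (r : R) m : mon (const_mx r) m = r ^+ mdeg m.
Proof. by rewrite /mon mdegE expr_sum; apply: eq_bigr => i _; rewrite mxE. Qed.

Lemma monZ (t : R) x m : mon (t *: x) m = t ^+ mdeg m * mon x m.
Proof.
by rewrite -(mon_const t m) /mon -big_split; apply: eq_bigr => i _ /=;
  rewrite !mxE exprMn.
Qed.

Lemma fps_termE f x m : fps_term f x m = f m * mon x m. Proof. by []. Qed.

Lemma normr_mon x m : `|mon x m| = mon (map_mx Num.norm x) m.
Proof. by rewrite /mon normr_prod; apply: eq_bigr => i _; rewrite normrX mxE. Qed.

Lemma ler_norm_mon x y m : (forall i, `|x 0 i| <= `|y 0 i|) -> `|mon x m| <= `|mon y m|.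
Proof.
move=> xy; rewrite !normr_mon /mon; apply: ler_prod => i _; rewrite !mxE.
by rewrite exprn_ge0//= lerXn2r// nnegrE.
Qed.

Lemma abs_converges_le f x y : (forall i, `|x 0 i| <= `|y 0 i|) ->
  abs_converges f y -> abs_converges f x.
Proof.
move=> xy /summable_fps[C fC]; apply/summable_fps; exists C => N.
apply: le_trans (fC N); apply: le_psum => m.
by rewrite /fps_abs !fps_termE !normrM ler_wpM2l// ler_norm_mon.
Qed.

Lemma convergentP f :
  convergent f <-> exists2 r : R, 0 < r & abs_converges f (const_mx r).
Proof.
split=> [/nbhs_ballP[e /= e0 fe]|[r r0 fr]].
  exists (e / 2); first by rewrite divr_gt0.
  apply: fe; split=> // i j; rewrite !mxE /ball /= sub0r normrN gtr0_norm ?divr_gt0//.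
  by rewrite ltr_pdivrMr// ltr_pMr// ltr1n.
apply/nbhs_ballP; exists r => // x [_ xr]; apply: abs_converges_le fr => i.
have := xr 0 i; rewrite !mxE /ball /= sub0r normrN => xi.
by rewrite (gtr0_norm r0) ltW.
Qed.

Lemma near0_le (r : R) : 0 < r ->
  \forall x \near (0 : 'rV[R]_n), forall i, `|(x : 'rV[R]_n) 0 i| < r.
Proof.
move=> r0; apply/nbhs_ballP; exists r => // x [_ xr] i.
by have := xr 0 i; rewrite !mxE /ball /= sub0r normrN.
Qed.

Lemma fps_sum_le f x (C : R) :
  (forall N, psum N (fps_abs (fps_term f x)) <= C) -> `|fps_sum f x| <= C.
Proof.
move=> fC; have cf : cvgn (fun N => psum N (fps_term f x)).
  by apply: fps_bounded_cvg; exists C.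
rewrite ler_norml; apply/andP; split; [apply: limr_ge|apply: limr_le] => //;
  near=> N; have := le_trans (ler_norm_psum N _) (fC N);
  by rewrite ler_norml => /andP[].
Unshelve. all: by end_near. Qed.

(** When the radius decreases from [r] to [s], every monomial of degree at least [N] shrinks at
    least by the factor [(s / r) ^+ N]. *)
Lemma fps_sum_ordge f (r : R) N : 0 < r -> abs_converges f (const_mx r) ->
  ordge N f -> exists2 C, 0 <= C & forall (s : R) x, 0 <= s -> s <= r ->
    (forall i, `|x 0 i| <= s) -> `|fps_sum f x| <= C * s ^+ N.
Proof.
move=> r0 /summable_fps[C fC] fN; have C0 : 0 <= C.
  by apply: le_trans (fC 0); apply: psum_ge0 => m; apply: normr_ge0.
exists (C / r ^+ N); first by rewrite divr_ge0// exprn_ge0// ltW.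
move=> s x s0 sr xs; apply: fps_sum_le => M.
rewrite (_ : C / _ * _ = (s / r) ^+ N * C); last by rewrite expr_div_n; ring.
apply: (@le_trans _ _ ((s / r) ^+ N * psum M (fps_abs (fps_term f (const_mx r)))));
  last by rewrite ler_wpM2l// exprn_ge0// divr_ge0// ltW.
rewrite /psum mulr_sumr; apply: ler_sum => m _; rewrite /fps_abs !fps_termE !normrM.
have [mN|Nm] := ltnP (mdeg m) N; first by rewrite fN// normr0 !mul0r mulr0.
rewrite mulrCA ler_wpM2l//; apply: (@le_trans _ _ (s ^+ mdeg m)).
  rewrite -(ger0_norm (exprn_ge0 _ s0)) -mon_const; apply: ler_norm_mon => i.
  by rewrite mxE (ger0_norm s0).
rewrite mon_const (ger0_norm (exprn_ge0 _ (ltW r0))).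
rewrite -(@ler_pdivrMr _ (r ^+ mdeg m)) ?exprn_gt0// -expr_div_n.
apply: ler_wiXn2l => //; first by rewrite divr_ge0// ltW.
by rewrite ler_pdivrMr// mul1r.
Qed.

Definition supported_lt (N : nat) f := forall m, (N <= mdeg m)%N -> f m = 0.

Lemma psum_supported_lt N M f : supported_lt N f -> (N <= M)%N -> psum M f = psum N f.
Proof.
move=> fN NM; rewrite -(psum_cut f NM); congr psum; apply/funext => m.
by rewrite /fps_cut; case: ltnP => // /fN.
Qed.

Lemma supported_lt_abs_converges N f x : supported_lt N f -> abs_converges f x.
Proof.
move=> fN; have tN : supported_lt N (fps_abs (fps_term f x)).
  by move=> m /fN fm; rewrite /fps_abs fps_termE fm mul0r normr0.
apply/summable_fps; exists (psum N (fps_abs (fps_term f x))) => M.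
have [MN|/ltnW NM] := leqP M N; last by rewrite (psum_supported_lt tN NM).
by apply: psum_nd => // m; apply: normr_ge0.
Qed.

Lemma supported_lt_fps_sum N f x : supported_lt N f ->
  fps_sum f x = psum N (fps_term f x).
Proof.
move=> fN; apply: cvg_lim => //.
have tN : supported_lt N (fps_term f x).
  by move=> m /fN fm; rewrite fps_termE fm mul0r.
apply: cvg_near_cst; near=> M; apply: (psum_supported_lt tN).
by near: M; exact: nbhs_infty_ge.
Unshelve. all: by end_near. Qed.

Lemma psum_delta N (f : fps R n) a : (mdeg a < N)%N ->
  (forall m, m != a -> f m = 0) -> psum N f = f a.
Proof.
move=> aN fa; rewrite /psum (bigD1 (BMultinom aN))//= big1 ?addr0// => m.
by rewrite bmeqP /= => ma; rewrite fa.
Qed.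

Lemma fpsC_supported (c : R) : supported_lt 1 (@fpsC R n c).
Proof. by move=> m m0; rewrite /fpsC; case: eqP m0 => // ->; rewrite mdeg0. Qed.

Lemma fpsX_supported a : supported_lt (mdeg a).+1 (fpsX R a).
Proof. by move=> m am; rewrite /fpsX; case: eqP am => // ->; rewrite ltnn. Qed.

Lemma fps_sumC (c : R) x : fps_sum (@fpsC R n c) x = c.
Proof.
rewrite (supported_lt_fps_sum _ (fpsC_supported c)) (@psum_delta _ _ mnm0).
- by rewrite fps_termE /fpsC eqxx mon0 mulr1.
- by rewrite mdeg0.
- by move=> m /negbTE m0; rewrite fps_termE /fpsC m0 mul0r.
Qed.

Lemma fps_sumX a x : fps_sum (fpsX R a) x = mon x a.
Proof.
rewrite (supported_lt_fps_sum _ (@fpsX_supported a)) (@psum_delta _ _ a)//.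
- by rewrite fps_termE /fpsX eqxx mul1r.
- by move=> m /negbTE m0; rewrite fps_termE /fpsX m0 mul0r.
Qed.

Lemma supported_lt_convergent N f : supported_lt N f -> convergent f.
Proof. by move=> fN; near=> x; apply: supported_lt_abs_converges fN.
Unshelve. all: by end_near. Qed.

Definition mkcps f (cf : convergent f) : cps R n := Cps (introT (asboolP _) cf).

Definition cpsC (c : R) : cps R n := mkcps (supported_lt_convergent (fpsC_supported c)).
Definition cpsX a : cps R n := mkcps (supported_lt_convergent (@fpsX_supported a)).
Definition cpsU i : cps R n := cpsX (mnm1 i).

Lemma val_cps_sum (T : Type) (r : seq T) (P : pred T) (F : T -> cps R n) :
  (\sum_(i <- r | P i) F i : cps R n) = \sum_(i <- r | P i) (F i : fps R n) :> fps R n.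
Proof. exact: (raddf_sum (val : cps R n -> fps R n)). Qed.

Lemma val_cpsM (f g : cps R n) : (f * g : cps R n) = (f : fps R n) * (g : fps R n) :> fps R n.
Proof. by []. Qed.

Lemma val_cpsD (f g : cps R n) : (f + g : cps R n) = (f : fps R n) + (g : fps R n) :> fps R n.
Proof. by []. Qed.

Lemma val_cpsB (f g : cps R n) : (f - g : cps R n) = (f : fps R n) - (g : fps R n) :> fps R n.
Proof. by []. Qed.

Lemma cps_eqP (f g : cps R n) : (forall m, coef f m = coef g m) -> f = g.
Proof. by move=> fg; apply: val_inj; apply/funext. Qed.

Lemma cps_conv (f : cps R n) : exists2 r : R, 0 < r & abs_converges f (const_mx r).
Proof. exact/convergentP/cps_convergent. Qed.

Lemma abs_converges_sub (f g : fps R n) x :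
  abs_converges f x -> abs_converges g x -> abs_converges (f - g) x.
Proof. by move=> cf cg; apply: abs_convergesD => //; apply: abs_convergesN. Qed.

Lemma fps_sumN (f : fps R n) x : abs_converges f x -> fps_sum (- f) x = - fps_sum f x.
Proof.
move=> cf; apply/eqP; rewrite -addr_eq0 -fps_sumD//; last exact: abs_convergesN.
by rewrite addNr fps_sum0.
Qed.

Lemma fps_sumB (f g : fps R n) x : abs_converges f x -> abs_converges g x ->
  fps_sum (f - g) x = fps_sum f x - fps_sum g x.
Proof. by move=> cf cg; rewrite fps_sumD ?fps_sumN//; apply: abs_convergesN. Qed.

Lemma fps_sum_at0 f : fps_sum f 0 = f mnm0.
Proof.
apply: cvg_lim => //; apply: cvg_near_cst; near=> N.
rewrite (@psum_delta _ _ mnm0); first by rewrite fps_termE mon0 mulr1.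
  by rewrite mdeg0; near: N; exact: nbhs_infty_gt.
move=> m; rewrite -mdeg_eq0 mdegE sum_nat_eq0 negb_forall => /existsP[i /= mi].
by rewrite fps_termE /mon (bigD1 i)//= mxE expr0n (negbTE mi) mul0r mulr0.
Unshelve. all: by end_near. Qed.

End Convergence.

(** * Weights adapted to the degree-lexicographic order *)

Section Weights.
Variable n : nat.
Implicit Types (a b m : multinom n) (w : 'I_n -> nat).

Definition wt w m : nat := (\sum_i w i * m i)%N.

(** The weight of variable [i] is [L + D ^ (n - 1 - i)]. The constant [L] exceeds the contribution
    of the powers of [D] to the weight of [a], so degrees are compared first. For equal degrees the
    exponents are at most [k < D], so the powers of [D] compare them like digits, that is,
    lexicographically. *)
Lemma deglex_weight (k : nat) : exists2 w, (forall i, (0 < w i)%N) &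
  forall a b, (mdeg a <= k)%N -> (a < b)%O -> (wt w a < wt w b)%N.
Proof.
pose D := k.+1; pose v (i : 'I_n) := (D ^ (n.-1 - i))%N.
pose L := (D ^ n * k).+1.
have D0 : (0 < D)%N by [].
have wtE m : wt (fun i => L + v i)%N m = (L * mdeg m + wt v m)%N.
  by rewrite /wt mdegE big_distrr -big_split; apply: eq_bigr => i _; rewrite mulnDl.
exists (fun i => L + v i)%N => // a b ak ab.
have := lemc_mdeg (ltW ab); rewrite leq_eqVlt => /orP[/eqP dab|dab]; last first.
  have va : (wt v a <= D ^ n * k)%N.
    apply: (@leq_trans (D ^ n * mdeg a)); last by rewrite leq_mul2l ak orbT.
    rewrite mdegE big_distrr; apply: leq_sum => i _ /=; rewrite leq_mul2r.
    by rewrite leq_pexp2l ?orbT//; lia.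
  rewrite !wtE; apply: (@leq_trans (L * (mdeg a).+1)).
    by rewrite mulnS [(L + _)%N]addnC ltn_add2l.
  by apply: (@leq_trans (L * mdeg b)); rewrite ?leq_addr// leq_mul2l dab orbT.
have /ltmcP := ab => /(_ dab)[i eqi lti].
rewrite !wtE dab ltn_add2l /wt.
rewrite (bigID (fun j : 'I_n => j < i)%N) [ltnRHS](bigID (fun j : 'I_n => j < i)%N)/=.
rewrite (eq_bigr (fun j => v j * b j)%N) => [|j ji]; last by rewrite eqi.
rewrite ltn_add2l (bigD1 i) ?ltnn//= [ltnRHS](bigD1 i) ?ltnn//=.
set S := (\sum_(_ < _ | _) _)%N; set S' := (\sum_(_ < _ | _) _)%N.
suff Sv : (S < v i)%N.
  apply: (@leq_trans (v i * (a i).+1 + S')); last by rewrite leq_add2r leq_mul2l lti orbT.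
  by rewrite mulnSr -addnA ltn_add2l ltn_addr.
rewrite -(ltn_pmul2l D0); apply: (@leq_ltn_trans (v i * k)); last first.
  by rewrite mulnC ltn_pmul2r// expn_gt0.
apply: (@leq_trans (v i * mdeg a)); last by rewrite leq_mul2l ak orbT.
rewrite mdegE !big_distrr/= [leqLHS]big_mkcond; apply: leq_sum => j _ /=.
case: ifP => // /andP[ij ji]; rewrite mulnA leq_mul2r; apply/orP; right.
rewrite /v -expnS leq_pexp2l//; move: ji; rewrite -val_eqE/= => ji.
by have := ltn_ord j; move: ij ji; rewrite -leqNgt; lia.
Qed.

End Weights.

Section WeightedRadius.
Variables (R : realType) (n : nat).
Implicit Types (f g : fps R n) (a b m : multinom n) (w : 'I_n -> nat) (t : R).

(** At this polyradius the monomial [m] has size [t ^+ wt w m]; with weights that refine the order,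
    lower exponents dominate as [t] tends to 0. *)
Definition wrow w t : 'rV[R]_n := \row_i t ^+ w i.

Lemma mon_wrow w t m : mon (wrow w t) m = t ^+ wt w m.
Proof.
by rewrite /mon /wt expr_sum; apply: eq_bigr => i _; rewrite mxE exprM.
Qed.

Definition tail_at f a : fps R n := fun m => if m == a then 0 else f m.

Lemma tail_atE f a : f = fpsC (f a) * fpsX R a + tail_at f a :> fps R n.
Proof.
apply/funext => m; rewrite fpsD fpsCM /fpsX /tail_at.
by case: eqP => [->|_]; rewrite (mulr1, mulr0) (addr0, add0r).
Qed.

Lemma wrow_abs_converges w f : (forall i, (0 < w i)%N) -> convergent f ->
  exists2 t0 : R, 0 < t0 <= 1 & forall t, 0 < t <= t0 -> abs_converges f (wrow w t).
Proof.
move=> w0 /convergentP[r r0 fr]; exists (Num.min r 1) => [|t].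
  by rewrite lt_min r0 ltr01 ge_min lexx orbT.
case/andP => t0; rewrite le_min => /andP[tr t1].
apply: abs_converges_le fr => i; rewrite !mxE (gtr0_norm r0).
rewrite (ger0_norm (exprn_ge0 _ (ltW t0))); apply: le_trans tr.
by rewrite -{2}(expr1 t) ler_wiXn2l// ltW.
Qed.

(** Every exponent of the tail has weight at least [wt w a + 1]. Going from a fixed radius [u] to
    [t] therefore gains the factor [(t / u) ^+ (wt w a).+1], which is one power of [t] better than
    the monomial [a]. *)
Lemma tail_small f a w (e : R) : convergent f -> initial f a ->
  (forall i, (0 < w i)%N) -> (forall b, (a < b)%O -> (wt w a < wt w b)%N) ->
  0 < e -> exists2 t0 : R, 0 < t0 & forall t, 0 < t <= t0 ->
    abs_converges f (wrow w t) /\ forall N,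
      psum N (fps_abs (fps_term (tail_at f a) (wrow w t))) <= e * mon (wrow w t) a.
Proof.
move=> cf [_ fa] w0 wa e0.
have [u /andP[u0 u1] fu] := wrow_abs_converges w0 cf.
have /summable_fps[C fC] : abs_converges f (wrow w u) by apply: fu; rewrite u0/=.
have C0 : 0 <= C.
  by apply: le_trans (fC 0); apply: psum_ge0 => m; apply: normr_ge0.
(* For [t <= d] the surplus power of [t] absorbs both [C / u ^+ (wt w a).+1] and the factor [e];
   dividing by [C + 1] avoids the case [C = 0]. *)
pose d := u ^+ (wt w a).+1 * e / (C + 1).
have d0 : 0 < d by rewrite divr_gt0 ?mulr_gt0 ?exprn_gt0// ltr_wpDl.
exists (Num.min u d); first by rewrite lt_min u0.
move=> t /andP[t0]; rewrite le_min => /andP[tu td].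
split=> [|N]; first by apply: fu; rewrite t0.
apply: (@le_trans _ _ ((t / u) ^+ (wt w a).+1 * C)).
  apply: (@le_trans _ _ ((t / u) ^+ (wt w a).+1 *
      psum N (fps_abs (fps_term f (wrow w u))))); last first.
    by rewrite ler_wpM2l// exprn_ge0// divr_ge0// ltW.
  rewrite /psum mulr_sumr; apply: ler_sum => m _.
  rewrite /fps_abs !fps_termE !mon_wrow !normrM !(ger0_norm (exprn_ge0 _ (ltW _)))//.
  rewrite /tail_at; case: eqP => [_|/eqP ma].
    by rewrite normr0 mul0r mulr_ge0 ?exprn_ge0 ?divr_ge0 ?mulr_ge0 ?exprn_ge0// ltW.
  have [am|/fa ->|am] := ltgtP a m; last by rewrite am eqxx in ma.
    2: by rewrite normr0 !mul0r mulr0.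
  rewrite mulrCA ler_wpM2l// -ler_pdivrMr ?exprn_gt0// -expr_div_n.
  apply: ler_wiXn2l; last exact: wa.
    by rewrite divr_ge0// ltW.
  by rewrite ler_pdivrMr// mul1r.
rewrite mon_wrow expr_div_n exprS.
have -> : t * t ^+ wt w a / u ^+ (wt w a).+1 * C =
   (t * C / u ^+ (wt w a).+1) * t ^+ wt w a by ring.
rewrite ler_wpM2r ?(exprn_ge0 _ (ltW t0))// ler_pdivrMr ?exprn_gt0//.
apply: (@le_trans _ _ (t * (C + 1))); first by rewrite ler_wpM2l ?lerDl// ltW.
by rewrite -ler_pdivlMr ?ltr_wpDl// [e * _]mulrC.
Qed.

Lemma wrow_near0 w (P : set 'rV[R]_n) : (forall i, (0 < w i)%N) ->
  nbhs (0 : 'rV[R]_n) P ->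
  exists2 t0 : R, 0 < t0 & forall t, 0 < t <= t0 -> P (wrow w t).
Proof.
move=> w0 /nbhs_ballP[e /= e0 eP]; exists (Num.min (e / 2) 1).
  by rewrite lt_min divr_gt0//= ltr01.
move=> t /andP[t0]; rewrite le_min => /andP[te t1]; apply: eP; split=> // i j.
rewrite !mxE /ball /= sub0r normrN (ger0_norm (exprn_ge0 _ (ltW t0))).
apply: (@le_lt_trans _ _ t); first by rewrite -{2}(expr1 t) ler_wiXn2l// ltW.
by apply: le_lt_trans te _; rewrite ltr_pdivrMr// ltr_pMr// ltr1n.
Qed.

(** At a small radius [wrow w u] the tail is at most half the initial term, so the sum cannot vanish
    there unless the initial coefficient does. *)
Lemma fps_identity f : convergent f ->
  (\forall x \near (0 : 'rV[R]_n), fps_sum f x = 0) -> f = 0.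
Proof.
move=> cf f0; apply/eqP; apply: contrapT => /negP /initial_exists[a fa].
have [w w0 wa] := deglex_weight n (mdeg a).
have e0 : 0 < `|f a| / 2 by rewrite divr_gt0// normr_gt0; case: fa.
have [t t0 ft] := tail_small cf fa w0 (fun b => wa _ b (leqnn _)) e0.
have [s s0 fs] := wrow_near0 w0 f0.
pose u := Num.min t s; have u0 : 0 < u by rewrite lt_min t0.
have [fu gu] : abs_converges f (wrow w u) /\ forall N,
    psum N (fps_abs (fps_term (tail_at f a) (wrow w u))) <=
     `|f a| / 2 * mon (wrow w u) a.
  by apply: ft; rewrite u0 ge_min lexx.
have /fs : 0 < u <= s by rewrite u0 ge_min lexx orbT.
have cg : abs_converges (tail_at f a) (wrow w u) by apply/summable_fps; eexists; exact: gu.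
have cC x : abs_converges (@fpsC R n (f a)) x.
  exact: supported_lt_abs_converges (@fpsC_supported _ _ _).
have cX x : abs_converges (fpsX R a) x.
  exact: supported_lt_abs_converges (@fpsX_supported _ _ _).
rewrite [in fps_sum _ _](tail_atE f a) fps_sumD//; last exact: abs_convergesM.
rewrite fps_sumM// fps_sumC fps_sumX => /eqP; rewrite addr_eq0 => /eqP fE.
have := fps_sum_le gu; rewrite -normrN -fE normrM mon_wrow.
rewrite (ger0_norm (exprn_ge0 _ (ltW u0))) ler_pM2r ?exprn_gt0//.
by rewrite leNgt ltr_pdivrMr// ltr_pMr ?ltr1n// normr_gt0; case: fa => ->.
Qed.

End WeightedRadius.

(** * Division *)

Section Division.
Variables (R : realType) (n : nat).
Implicit Types (f g h u v : fps R n) (a b m : multinom n).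

(** The coefficient at [b] of [Phi u] uses only coefficients of [u] below [b], so the fixed point is
    defined by well-founded recursion; in [G] the coefficients not below [b] are set to 0. *)
Lemma causal_fixpoint (Phi : fps R n -> fps R n) :
  (forall u v b, (forall a, (a < b)%O -> u a = v a) -> Phi u b = Phi v b) ->
  exists u, u = Phi u.
Proof.
move=> causal.
pose G b (rec : forall a, (a < b)%O -> R) : R :=
  Phi (fun a => if pselect (a < b)%O is left ab then rec a ab else 0) b.
pose u := Fix (@ltom_wf n) (fun=> R) G; exists u; apply/funext => b.
rewrite {1}/u Fix_eq; last first.
  move=> x p q pq; rewrite /G; congr Phi; apply/funext => a.
  by case: pselect => // ax; rewrite pq.
by apply: causal => a ab; case: pselect.
Qed.

Lemma psum_fpsXM N a f : psum (N + mdeg a) (fpsX R a * f) = psum N f.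
Proof.
rewrite [LHS]psum_mul.
have aN : (mdeg a < (N + mdeg a).+1)%N by lia.
transitivity (psum (N + mdeg a) (fps_cut N f)); last by rewrite psum_cut// leq_addr.
rewrite -(pair_big_dep predT
  (fun k1 k2 : bmultinom n (N + mdeg a) => (mdeg (mnm_add k1 k2) < N + mdeg a)%N)
  (fun k1 k2 => fpsX R a k1 * f k2))/=.
have [N0|N0] := posnP N.
  rewrite N0 [LHS]big1 => [|k1 _]; last first.
    rewrite /fpsX; case: eqP => k1a; last by apply: big1 => *; rewrite mul0r.
    by have := bmdeg k1; rewrite k1a; lia.
  by rewrite /psum big1// => k _; rewrite /fps_cut ltn0.
have aN' : (mdeg a < N + mdeg a)%N by lia.
rewrite (bigD1 (BMultinom aN'))//= [X in _ + X]big1 ?addr0 => [|k].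
  rewrite /psum [RHS](bigID (fun k : bmultinom n (N + mdeg a) => (mdeg k < N)%N))/=.
  rewrite [X in _ = _ + X]big1 ?addr0 => [|k /negbTE kN]; last by rewrite /fps_cut kN.
  apply: eq_big => [k|k]; first by rewrite mdegD addnC ltn_add2r.
  rewrite /fpsX eqxx mul1r mdegD addnC ltn_add2r => kN.
  by rewrite /fps_cut kN.
rewrite bmeqP /= => /negbTE ka; apply: big1 => k2 _.
by rewrite /fpsX ka mul0r.
Qed.

(** The weighted l^1 norm at polyradius [x], truncated in degree. The truncation keeps it finite for
    every formal series, so estimates can precede convergence. *)
Definition p_norm (x : 'rV[R]_n) N f := psum N (fps_abs (fps_term f x)).

Lemma p_norm_ge0 x N f : 0 <= p_norm x N f.
Proof. by apply: psum_ge0 => m; apply: normr_ge0. Qed.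

Lemma p_normD x N f g : p_norm x N (f + g) <= p_norm x N f + p_norm x N g.
Proof.
rewrite /p_norm -psumD; apply: le_psum => m.
by rewrite fpsD /fps_abs fps_termD ler_normD.
Qed.

Lemma p_normN x N f : p_norm x N (- f) = p_norm x N f.
Proof. by congr psum; apply/funext => m; rewrite /fps_abs fps_termN normrN. Qed.

Lemma p_norm0 x N : p_norm x N 0 = 0.
Proof.
by rewrite /p_norm /psum big1// => m _; rewrite /fps_abs fps_termE mul0r normr0.
Qed.

Lemma p_norm_sum x N (T : Type) (r : seq T) (F : T -> fps R n) :
  p_norm x N (\sum_(i <- r) F i) <= \sum_(i <- r) p_norm x N (F i).
Proof.
elim: r => [|i r IH]; first by rewrite !big_nil p_norm0.
by rewrite !big_cons; apply: le_trans (p_normD _ _ _ _) _; rewrite lerD2l.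
Qed.

Lemma p_normM x N f g : p_norm x N (f * g) <= p_norm x N f * p_norm x N g.
Proof.
apply: le_trans (psum_mul_le _ _ _); rewrite ?/fps_abs//.
apply: le_psum => m; rewrite /fps_abs fps_termM.
by apply: le_trans (ler_norm_sum _ _ _) _; apply: ler_sum => k _; rewrite normrM.
Qed.

Lemma eq_p_norm x N f g : (forall m, (mdeg m < N)%N -> f m = g m) ->
  p_norm x N f = p_norm x N g.
Proof.
by move=> fg; apply: eq_bigr => m _; rewrite /fps_abs !fps_termE fg// bmdeg.
Qed.

Lemma wrow_convergent (w : 'I_n -> nat) (t : R) f : 0 < t <= 1 ->
  abs_converges f (wrow w t) -> convergent f.
Proof.
move=> /andP[t0 t1] ft; apply/convergentP; exists (t ^+ (\sum_i w i)%N).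
  by rewrite exprn_gt0.
apply: abs_converges_le ft => i; rewrite !mxE !(ger0_norm (exprn_ge0 _ (ltW t0))).
by apply: ler_wiXn2l => //; [exact: ltW|rewrite (bigD1 i)//= leq_addr].
Qed.

Variables (k c : nat) (alpha : 'I_k -> multinom n) (F : 'I_k -> fps R n).
Hypothesis F_initial : forall i, initial (F i) (alpha i).
Hypothesis F_monic : forall i, F i (alpha i) = 1.
Hypothesis alpha_c : forall i, (mdeg (alpha i) <= c)%N.

(** [sel] assigns each exponent divisible by some [alpha i] to one such [i]; the others go to the
    remainder. The exponents of [u] are thus split into disjoint pieces. *)
Definition sel b : option 'I_k := [pick i | lem (alpha i) b].
Definition quo u i : fps R n :=
  fun m => if sel (mnm_add m (alpha i)) == Some i then u (mnm_add m (alpha i)) else 0.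
Definition rmd u : fps R n := fun b => if sel b == None then u b else 0.
(** A fixed point satisfies [h = u + \sum_i quo u i * tail_i]; splitting [u] into its pieces turns
    this into the division of [h] by the [F i]. *)
Definition reduce h u : fps R n := h - \sum_i quo u i * tail_at (F i) (alpha i).

Lemma quo_rmdE u : u = \sum_i quo u i * fpsX R (alpha i) + rmd u.
Proof.
apply/funext => m; rewrite fpsD fps_sumE /rmd.
have E i : (quo u i * fpsX R (alpha i)) m = if sel m == Some i then u m else 0.
  rewrite mulrC fpsXM /quo; case: ifP => im; first by rewrite submK.
  rewrite /sel; case: pickP => [j jm|//]; case: eqP => // -[ji].
  by rewrite ji im in jm.
under eq_bigr do rewrite E.
case: (sel m) => [j|] /=; last by rewrite big1 ?add0r// => i _.
rewrite addr0 (bigD1 j)//= eqxx big1 ?addr0// => i /negbTE ij.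
by case: eqP => // -[ji]; rewrite ji eqxx in ij.
Qed.

Lemma tail_at_gt i m : tail_at (F i) (alpha i) m != 0 -> (alpha i < m)%O.
Proof.
rewrite /tail_at; have [_|ma] := eqVneq m (alpha i); first by rewrite eqxx.
have [//|mi|am] := ltgtP (alpha i) m; last by rewrite am eqxx in ma.
by have [_ ->] := F_initial i; rewrite ?eqxx.
Qed.

(** The tail of [F i] starts strictly after [alpha i], so the coefficient of [u] at [m + alpha i]
    enters only at exponents strictly above it. *)
Lemma reduce_causal h u v b :
  (forall a, (a < b)%O -> u a = v a) -> reduce h u b = reduce h v b.
Proof.
move=> uv; rewrite /reduce !fpsB !fps_sumE; congr (_ - _); apply: eq_bigr => i _.
rewrite !fpsM; apply: eq_bigr => m mb.
have [->|/tail_at_gt im] := eqVneq (tail_at (F i) (alpha i) (mnm_sub b m)) 0.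
  by rewrite !mulr0.
congr (_ * _); rewrite /quo uv//.
have : (mnm_add m (alpha i) < mnm_add m (mnm_sub b m))%O by rewrite ltmc_add2r.
by rewrite [mnm_add m (mnm_sub b m)]addmC submK.
Qed.

Lemma reduce_exists h : exists u, u = reduce h u.
Proof. by apply: causal_fixpoint => u v b; apply: reduce_causal. Qed.

Lemma reduceE h u : u = reduce h u ->
  h = \sum_i quo u i * F i + rmd u.
Proof.
move=> uE; have hE : h = u + \sum_i quo u i * tail_at (F i) (alpha i).
  by rewrite {1}uE /reduce subrK.
rewrite hE {1}(quo_rmdE u) addrAC -big_split; congr (_ + _).
apply: eq_bigr => i _; rewrite [in RHS](tail_atE (F i) (alpha i)) F_monic /=.
rewrite mulrDr; congr (_ * _ + _); apply/funext => m; rewrite fpsCM mul1r//.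
Qed.

Lemma reduce_ordge h u N : u = reduce h u -> ordge N h -> ordge N u.
Proof.
move=> uE hN; elim/(@ltmwf n) => b IH bN; rewrite uE.
rewrite (@reduce_causal h u 0) => [|a ab]; last first.
  by apply: IH => //; apply: leq_ltn_trans (lemc_mdeg (ltW ab)) bN.
rewrite /reduce fpsB fps_sumE big1 ?subr0 ?hN// => i _.
rewrite fpsM big1// => m _; rewrite /quo fps0; case: ifP => _; exact: mul0r.
Qed.

Lemma quo_ordge u N i : ordge N u -> ordge (N - c) (quo u i).
Proof.
move=> uN m mN; rewrite /quo uN ?if_same// mdegD.
by have := alpha_c i; lia.
Qed.

(** The series [quo u i] times the monomial [alpha i] are disjoint pieces of [u], so their norms add
    up to at most that of [u]. The shift by [c] accounts for the degrees of the [alpha i]. *)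
Lemma quo_p_norm (x : 'rV[R]_n) N u : \sum_i p_norm x N (quo u i) * `|mon x (alpha i)|
  <= p_norm x (N + c) u.
Proof.
have E i : p_norm x N (quo u i) * `|mon x (alpha i)| <=
   psum (N + c) (fun b => if sel b == Some i then `|u b * mon x b| else 0).
  rewrite /p_norm -(psum_fpsXM N (alpha i)).
  apply: (@le_trans _ _ (psum (N + c) (fpsX R (alpha i) *
      fps_abs (fps_term (quo u i) x)) * `|mon x (alpha i)|)).
    rewrite ler_wpM2r//; apply: psum_nd; last by rewrite leq_add2l.
    move=> m; rewrite fpsXM; case: ifP => // _; exact: normr_ge0.
  rewrite /psum mulr_suml; apply: ler_sum => b _; rewrite fpsXM.
  case: ifP => ib; last by rewrite mul0r; case: ifP.
  rewrite /fps_abs fps_termE /quo submK//; case: ifP => _; last first.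
    by rewrite mul0r normr0 mul0r.
  by rewrite -normrM -mulrA -monD submK.
apply: le_trans (ler_sum _ (fun i _ => E i)) _.
rewrite /p_norm /psum exchange_big; apply: ler_sum => b _ /=.
rewrite /fps_abs fps_termE; case: (sel b) => [j|]; last by rewrite big1.
rewrite (bigD1 j)//= eqxx big1 ?addr0// => i /negbTE ij.
by case: eqP => // -[ji]; rewrite ji eqxx in ij.
Qed.

(** The fixed point equation gives norm of [u] at most [C] plus [e] times norm of [u]. To have the
    same finite number on both sides, [u] is first cut at degree [N]: this leaves the coefficients
    of [reduce h u] below [N] unchanged, and the norm of [v] is the same at truncation [N] and
    [N + c]. *)
Lemma reduce_p_norm (x : 'rV[R]_n) h u (C e : R) : (forall i, 0 < x 0 i) ->
  u = reduce h u -> 0 <= e -> e < 1 ->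
  (forall N, p_norm x N h <= C) ->
  (forall i N, p_norm x N (tail_at (F i) (alpha i)) <= e * mon x (alpha i)) ->
  forall N, p_norm x N u <= C / (1 - e).
Proof.
move=> x0 uE e0 e1 hC Fe N; pose v : fps R n := fps_cut N u.
have cutE M : (N <= M)%N -> p_norm x M v = p_norm x N u.
  move=> NM; rewrite /p_norm -(psum_cut _ NM); congr psum; apply/funext => m.
  rewrite /fps_abs !fps_termE /v /fps_cut; case: ifP => // _.
  by rewrite mul0r normr0.
have uv : p_norm x N u = p_norm x N (reduce h v).
  rewrite {1}uE; apply: eq_p_norm => b bN; apply: reduce_causal => a ab.
  by rewrite /v /fps_cut (leq_ltn_trans (lemc_mdeg (ltW ab)) bN).
rewrite ler_pdivlMr ?subr_gt0// mulrBr mulr1 lerBlDr uv.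
apply: le_trans (p_normD _ _ _ _) _; rewrite p_normN lerD//.
apply: le_trans (p_norm_sum _ _ _ _) _; rewrite -uv.
apply: (@le_trans _ _ (\sum_i e * (p_norm x N (quo v i) * `|mon x (alpha i)|))).
  apply: ler_sum => i _; apply: le_trans (p_normM _ _ _ _) _.
  rewrite mulrCA ler_wpM2l ?p_norm_ge0// ger0_norm//.
  by apply: ltW; apply: mon_gt0.
rewrite -mulr_sumr mulrC ler_wpM2r// -(cutE (N + c)%N) ?leq_addr//.
exact: quo_p_norm.
Qed.

End Division.

(** * Initial exponents of an ideal and convergent division *)

Section InitialExponents.
Variables (R : realType) (n : nat).
Implicit Types (K : set (cps R n)) (f g h : cps R n) (a b m : multinom n).

Definition ini K : set (multinom n) := [set a | exists2 f, K f & initial f a].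

Lemma ini_monic K a : ideal K -> ini K a ->
  exists f, [/\ K f, initial f a & coef f a = 1].
Proof.
move=> [_ _ KM] [f Kf [fa fl]]; exists (cpsC n (coef f a)^-1 * f).
have E m : coef (cpsC n (coef f a)^-1 * f) m = (coef f a)^-1 * coef f m.
  by rewrite val_cpsM fpsCM.
split; [exact: KM|split|]; last by rewrite E mulVf.
- by rewrite E; apply: mulf_neq0; rewrite ?invr_eq0.
- by move=> b ba; rewrite E (fl _ ba) mulr0.
Qed.

Lemma min_pos_family (T : finType) (t : T -> R) : (forall i, 0 < t i) ->
  exists2 s : R, 0 < s & forall i, s <= t i.
Proof.
move=> t0; exists (\big[Num.min/1]_i t i); first by apply: lt_bigmin => //; exact: ltr01.
by move=> i; apply: bigmin_le.
Qed.

(* Grauert's division theorem: at the radius [t ^ w] with [t] small the tails of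
   the generators are small against their initial terms, so that reduction is a
   contraction. *)
Lemma ideal_division K : ideal K ->
  exists k (F : 'I_k -> cps R n) (c : nat), (forall i, K (F i)) /\
    forall h N, ordge N h -> exists (q : 'I_k -> cps R n) (r : cps R n),
      [/\ h = \sum_i q i * F i + r, forall i, ordge (N - c) (q i)
        & forall b, ini K b -> coef r b = 0].
Proof.
move=> idK; have [s [sK sD]] := dickson (ini K).
pose alpha (i : 'I_(size s)) := nth mnm0 s i.
have /choice[F FP] i : exists f, [/\ K f, initial f (alpha i) & coef f (alpha i) = 1].
  by apply: ini_monic => //; apply: sK; apply: mem_nth.
have FK i : K (F i) by case: (FP i).
have Fi i : initial (F i) (alpha i) by case: (FP i).
have F1 i : coef (F i) (alpha i) = 1 by case: (FP i).
pose c := (\max_i mdeg (alpha i))%N.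
have alc i : (mdeg (alpha i) <= c)%N by apply: leq_bigmax.
(* One weight serves all generators, because their initial exponents have degree at most [c]. *)
have [w w0 wc] := deglex_weight n c.
exists (size s), F, c; split=> // h N hN.
have [u uE] := reduce_exists Fi h.
have e0 : (0 : R) < 2^-1 by rewrite invr_gt0.
have /choice[t tP] i : exists t0 : R, 0 < t0 /\ forall t, 0 < t <= t0 ->
    abs_converges (F i) (wrow w t) /\ forall N,
      p_norm (wrow w t) N (tail_at (F i) (alpha i)) <= 2^-1 * mon (wrow w t) (alpha i).
  have [t0 ? tP] := tail_small (cps_convergent (F i)) (Fi i) w0
    (fun b => wc _ b (alc i)) e0.
  by exists t0.
have [t1 t10 tt1] := min_pos_family (fun i => (tP i).1).
have [t2 /andP[t20 t21] ht2] := wrow_abs_converges w0 (cps_convergent h).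
pose t0 := Num.min t1 t2; have t00 : 0 < t0 by rewrite lt_min t10.
have t01 : 0 < t0 <= 1 by rewrite t00 ge_min t21 orbT.
have x0 i : 0 < wrow w t0 0 i by rewrite mxE exprn_gt0.
have /summable_fps[C hC] : abs_converges h (wrow w t0).
  by apply: ht2; rewrite t00 ge_min lexx orbT.
have Fe i M : p_norm (wrow w t0) M (tail_at (F i) (alpha i)) <=
    2^-1 * mon (wrow w t0) (alpha i).
  have [_ tPi] := tP i; have [//|_ ->//] := tPi t0.
  by rewrite t00 ge_min tt1.
have e1 : (2^-1 : R) < 1 by rewrite invf_lt1// ltr1n.
have uC := reduce_p_norm Fi alc x0 uE (ltW e0) e1 hC Fe.
have cu (f : fps R n) : (forall m, `|f m| <= `|u m|) -> convergent f.
  move=> fu; apply: (wrow_convergent t01); apply/summable_fps.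
  exists (C / (1 - 2^-1)) => M; apply: le_trans (uC M); apply: le_psum => m.
  rewrite /fps_abs !fps_termE !normrM; apply: ler_wpM2r => //; exact: fu.
have cr : convergent (rmd alpha u).
  by apply: cu => m; rewrite /rmd; case: ifP => // _; rewrite normr0.
have cq i : convergent (quo alpha u i).
  apply: (wrow_convergent t01); apply/summable_fps.
  exists (C / (1 - 2^-1) / `|mon (wrow w t0) (alpha i)|) => M.
  rewrite ler_pdivlMr ?normr_gt0 ?gt_eqF ?mon_gt0//.
  apply: le_trans (uC (M + c)%N); apply: le_trans (quo_p_norm alc _ _ _).
  rewrite (bigD1 i)//=; apply: ler_wpDr; last exact: lexx.
  by apply: sumr_ge0 => j _; rewrite mulr_ge0// p_norm_ge0.
exists (fun i => mkcps (cq i)), (mkcps cr); split.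
- apply: cps_eqP => m; rewrite val_cpsD val_cps_sum.
  by rewrite {1}(reduceE F1 uE).
- by move=> i; apply: (quo_ordge alc); apply: reduce_ordge uE hN.
- move=> b /sD[a sa ab]; rewrite /= /rmd.
  suff -> : (sel alpha b == None) = false by [].
  rewrite /sel; case: pickP => // /(_ (Ordinal (etrans (index_mem a s) sa)))/=.
  by rewrite /alpha /= nth_index// ab.
Qed.

Lemma ini_ord K h : K h -> (forall b, ini K b -> coef h b = 0) -> h = 0.
Proof.
move=> Kh h0; apply: val_inj; apply/eqP; apply: contrapT => /negP.
move=> /initial_exists[a ha]; have [/eqP+ _] := ha; apply.
by apply: h0; exists h.
Qed.

Lemma ideal_sum (A : comNzRingType) (J : set A) (T : Type) (r : seq T) (F : T -> A) :
  ideal J -> (forall i, J (F i)) -> J (\sum_(i <- r) F i).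
Proof. by move=> [J0 JD _] JF; elim/big_ind: _. Qed.

Lemma idealN (A : comNzRingType) (J : set A) x : ideal J -> J x -> J (- x).
Proof. by move=> [_ _ JM] /(JM (-1)); rewrite mulN1r. Qed.

Lemma idealB (A : comNzRingType) (J : set A) x y : ideal J -> J x -> J y -> J (x - y).
Proof. by move=> idJ Jx Jy; have [_ JD _] := idJ; apply: JD => //; apply: idealN. Qed.

(** For an element of [K] the remainder lies in [K] and avoids [ini K], hence is 0. The loss of
    order [c] is independent of [h] and [N], which is what Artin-Rees requires. *)
Lemma ideal_generators K : ideal K ->
  exists k (F : 'I_k -> cps R n) (c : nat), (forall i, K (F i)) /\
    forall h N, K h -> ordge N h -> exists q : 'I_k -> cps R n,
      h = \sum_i q i * F i /\ forall i, ordge (N - c) (q i).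
Proof.
move=> idK; have [k [F [c [KF div]]]] := ideal_division idK.
exists k, F, c; split=> // h N Kh hN; have [q [r [hE qN rK]]] := div h N hN.
exists q; split=> //; rewrite hE; suff -> : r = 0 by rewrite addr0.
apply: (@ini_ord K) rK; have -> : r = h - \sum_i q i * F i by rewrite hE addrC addKr.
apply: idealB => //; apply: ideal_sum => // i; have [_ _ KM] := idK; exact: KM.
Qed.

Lemma ideal_remainder K h : ideal K -> exists2 r, K (h - r) &
  forall b, ini K b -> coef r b = 0.
Proof.
move=> idK; have [k [F [c [KF div]]]] := ideal_division idK.
have [q [r [hE _ rK]]] := div h 0%N (@ordge0 _ _ _); exists r => //.
rewrite hE addrK; apply: ideal_sum => // i; have [_ _ KM] := idK; exact: KM.
Qed.

Lemma ideal_span_ideal (A : comNzRingType) (S : set A) : ideal (ideal_span S).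
Proof.
split=> [|x y Sx Sy|a x Sx] J [idJ SJ]; have [J0 JD JM] := idJ => //.
  by apply: JD; [apply: Sx|apply: Sy].
by apply: JM; apply: Sx.
Qed.

Lemma sub_ideal_span (A : comNzRingType) (S : set A) : S `<=` ideal_span S.
Proof. by move=> x Sx J [_]; apply. Qed.

Lemma cps_noetherian : noetherian (cps R n).
Proof.
move=> K idK; have [k [F [c [KF gen]]]] := ideal_generators idK.
exists [seq F i | i : 'I_k]; apply/seteqP; split=> [h Kh|h]; last first.
  by move=> Sh; apply: Sh; split=> // _ /mapP[i _ ->]; exact: KF.
have [q [-> _]] := gen h 0%N Kh (@ordge0 _ _ _).
have idS := ideal_span_ideal [set` [seq F i | i : 'I_k]].
have := @ideal_sum _ _ 'I_k (index_enum _) (fun i => q i * F i) idS; apply => i.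
have [_ _ SM] := ideal_span_ideal [set` [seq F i | i : 'I_k]]; apply: SM.
by apply: sub_ideal_span => /=; apply/mapP; exists i => //; rewrite mem_enum.
Qed.

(** In the principal ideal of [h] every exponent is initial, since [h] has initial exponent 0. The
    remainder of 1 is then 0, so the ideal contains 1. *)
Lemma cps_unit h : coef h mnm0 != 0 -> exists g, g * h = 1.
Proof.
move=> h0; pose K : set (cps R n) := [set f | exists g, f = g * h].
have idK : ideal K.
  split; first by exists 0; rewrite mul0r.
    by move=> _ _ [x ->] [y ->]; exists (x + y); rewrite mulrDl.
  by move=> a _ [x ->]; exists (a * x); rewrite mulrA.
have [r [g gE] r0] := ideal_remainder 1 idK; exists g; rewrite -gE.
suff -> : r = 0 by rewrite subr0.
apply: cps_eqP => b; apply: r0; exists (cpsX R b * h); first by exists (cpsX R b).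
have hi : initial h mnm0.
  by split=> // m; rewrite ltNge le0x.
have bi : initial (cpsX R b) b.
  split=> [|m mb]; first by rewrite /= /fpsX eqxx oner_eq0.
  by rewrite /= /fpsX lt_eqF.
by have := initialM bi hi; rewrite addm0.
Qed.

End InitialExponents.

(** * Chains of primes *)

Section Dimension.
Variables (R : realType) (n : nat).
Implicit Types (K P Q : set (cps R n)) (f g h x : cps R n) (a b m : multinom n).

(** Membership in [P] plus the [N]-th power of the maximal ideal. *)
Definition modord P N f := exists2 p, P p & ordge N (f - p : cps R n).

(** Division is applied in the ideal generated by [P] and [x]. If [x * f - p0] has order [N], its
    quotients have order [N - c], and their [x]-parts form a series [s] of that order with
    [x * (f - s)] in [P]. Primality puts [f - s] in [P]. *)
Lemma artin_rees P x : prime_ideal P -> ~ P x ->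
  exists c, forall N f, modord P N (x * f) -> modord P (N - c) f.
Proof.
move=> [idP P1 Pprime] Px; have [P0 PD PM] := idP.
pose K : set (cps R n) := [set f | exists2 p, P p & exists g, f = p + g * x].
have idK : ideal K.
  split; first by exists 0 => //; exists 0; rewrite mul0r addr0.
    move=> _ _ [p Pp [g ->]] [q Pq [h ->]]; exists (p + q); first exact: PD.
    by exists (g + h); rewrite mulrDl addrACA.
  move=> a _ [p Pp [g ->]]; exists (a * p); first exact: PM.
  by exists (a * g); rewrite mulrDr mulrA.
have [k [F [c [KF gen]]]] := ideal_generators idK.
have /choice[p pP] i : exists p, P p /\ exists g, F i = p + g * x.
  by have [p Pp ?] := KF i; exists p.
have /choice[g gE] i : exists g, F i = p i + g * x by case: (pP i).
exists c => N f [p0 Pp0 fN].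
have Kh : K (x * f - p0).
  by exists (- p0); [exact: idealN|exists f; rewrite addrC mulrC].
have [q [hE qN]] := gen _ _ Kh fN.
pose s := \sum_i q i * g i.
have : P (x * (f - s)).
  have -> : x * (f - s) = p0 + \sum_i q i * p i.
    rewrite mulrBr; apply/eqP; rewrite subr_eq -addrA -subr_eq0 opprD addrA hE.
    rewrite /s mulr_sumr -big_split -sumrB big1// => i _ /=.
    by rewrite gE; ring.
  by apply: PD => //; apply: ideal_sum => // i; apply: PM; case: (pP i).
move=> /Pprime[//|Pfs]; exists (f - s) => //; rewrite opprB addrC subrK.
rewrite val_cps_sum; apply: ordge_sum => i _.
by rewrite -[(N - c)%N]addn0 val_cpsM; apply: ordgeM.
Qed.

Lemma artin_rees_exp P x : prime_ideal P -> ~ P x ->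
  exists c, forall k N f, modord P N (x ^+ k * f) -> modord P (N - c * k) f.
Proof.
move=> pP Px; have [c ar] := artin_rees pP Px; exists c.
elim=> [|k IH] N f; first by rewrite mul1r muln0 subn0.
by rewrite exprS -mulrA => /ar/IH; rewrite mulnS subnDA.
Qed.

(** Linear independence over [R] modulo [P] and the [N]-th power of the maximal ideal. *)
Definition indep (T : finType) (v : T -> cps R n) P N :=
  forall l : T -> R, modord P N (\sum_i cpsC n (l i) * v i) -> forall i, l i = 0.

(** A relation is grouped by powers of [x] and its coefficients are killed in increasing order of
    the power. Once those below [j] vanish, Artin-Rees divides out [x ^+ j] at the cost of order
    [c * j <= c * k]. Modulo [Q], which contains [x], only the block [B j] survives, and [v] is
    independent there. *)
Lemma indep_step P Q x : prime_ideal P -> ideal Q -> P `<=` Q -> Q x -> ~ P x ->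
  exists c, forall k (T : finType) (v : T -> cps R n) N, indep v Q N ->
    indep (fun i : 'I_k * T => x ^+ i.1 * v i.2) P (N + c * k).
Proof.
move=> pP idQ PQ Qx Px; have [c ar] := artin_rees_exp pP Px; exists c.
move=> k T v N vQ l lP.
pose B (j : 'I_k) := \sum_i cpsC n (l (j, i)) * v i.
have sumE : \sum_i cpsC n (l i) * (x ^+ i.1 * v i.2) = \sum_(j < k) x ^+ j * B j.
  transitivity (\sum_(p : 'I_k * T) cpsC n (l (p.1, p.2)) * (x ^+ p.1 * v p.2)).
    by apply: eq_bigr => -[].
  rewrite -(pair_bigA _ (fun (j : 'I_k) i => cpsC n (l (j, i)) * (x ^+ j * v i)))/=.
  by apply: eq_bigr => j _; rewrite mulr_sumr; apply: eq_bigr => i _; rewrite mulrCA.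
rewrite sumE in lP.
suff H (j : nat) (jk : (j < k)%N) i : l (Ordinal jk, i) = 0.
  by move=> [[j jk] i]; exact: H.
elim/ltn_ind: j jk i => j IH jk; apply: vQ; rewrite -/(B (Ordinal jk)).
have B0 (i : 'I_k) : (i < j)%N -> B i = 0.
  move=> ij; rewrite /B big1// => t _.
  have -> : i = Ordinal (ltn_ord i) by apply: val_inj.
  rewrite IH//; apply: cps_eqP => m; rewrite val_cpsM fpsCM mul0r//.
pose s := \sum_(i < k | (j < i)%N) x ^+ (i - j.+1) * B i.
have E : \sum_(i < k) x ^+ i * B i = x ^+ j * (B (Ordinal jk) + x * s).
  rewrite (bigID (fun i : 'I_k => (i < j)%N))/= big1 ?add0r => [|i /B0 ->]; last first.
    by rewrite mulr0.
  rewrite (bigD1 (Ordinal jk)) ?ltnn//= mulrDr; congr (_ + _).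
  rewrite /s !mulr_sumr; apply: eq_big => [i|i].
    by rewrite -leqNgt -val_eqE /= ltn_neqAle eq_sym andbC.
  rewrite -leqNgt -val_eqE/= => /andP[ji ij]; rewrite !mulrA -exprSr -exprD.
  by congr (x ^+ _ * _); lia.
move: lP; rewrite E => /ar[p Pp pN]; exists (p - x * s).
  apply: idealB => //; first exact: PQ.
  by have [_ _ QM] := idQ; rewrite mulrC; apply: QM.
rewrite opprB addrA; apply: ordgeW pN; have : (c * j <= c * k)%N by rewrite leq_mul2l ltnW// orbT.
by lia.
Qed.

Lemma proper_ideal_coef0 P f : ideal P -> ~ P 1 -> P f -> coef f mnm0 = 0.
Proof.
move=> [_ _ PM] P1 Pf; apply/eqP; apply: contrapT => /negP /cps_unit[g gf].
by apply: P1; rewrite -gf; apply: PM.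
Qed.

(* Elements [x_i] of [c i.+1] outside [c i] behave like parameters: by Artin-Rees
   their monomials of exponents below [k] stay independent modulo a power of the
   maximal ideal linear in [k]. *)
Lemma chain_indep s (c : nat -> set (cps R n)) : prime_chain s c ->
  exists C, forall k, exists T : finType, #|T| = (k ^ s)%N /\
    exists v : T -> cps R n, indep v (c 0) (1 + C * k).
Proof.
elim: s c => [|s IH] c [pc lc].
  have [idP P1 _] := pc 0 (leqnn _).
  exists 0%N => k; exists unit; rewrite card_unit; split=> //.
  exists (fun=> 1) => l [p Pp]; rewrite mul0n => lp [].
  have := lp mnm0; rewrite mdeg0 => /(_ isT).
  rewrite val_cpsB fpsB (proper_ideal_coef0 idP P1 Pp) subr0.
  rewrite (big_pred1 tt) => [|[]//]; rewrite val_cpsM fpsCM.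
  by rewrite [X in _ * X](fps1 R (@mnm0 n)) eqxx mulr1.
have [C' IHc] := IH (fun i => c i.+1) (conj (fun i (h : (i <= s)%N) => pc i.+1 h)
  (fun i (h : (i < s)%N) => lc i.+1 h)).
have [/existsNP[x /not_implyP[c1x c0x]] c01] : ~ (c 1 `<=` c 0) /\ c 0 `<=` c 1.
  by have [] := lc 0 isT.
have [idQ _ _] := pc 1 isT.
have [C0 step] := indep_step (pc 0 isT) idQ c01 c1x c0x.
exists (C' + C0)%N => k; have [T [Tk [v vi]]] := IHc k.
exists ('I_k * T)%type; rewrite card_prod card_ord Tk expnS; split=> //.
by rewrite mulnDl addnA; eexists; apply: step vi.
Qed.

(** The standard monomials of degree below [N]. *)
Definition std K N : {set bmultinom n N} := [set b : bmultinom n N | `[< ~ ini K b >]].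

(** Since [K] lies in [P], each [v i] may be replaced by its remainder modulo [K], which below
    degree [N] is a combination of standard monomials. A left kernel vector of the coefficient
    matrix [M] is then a relation among the [v i], so [M] has full row rank. *)
Lemma indep_card K P N (T : finType) (v : T -> cps R n) :
  ideal K -> ideal P -> K `<=` P -> indep v P N -> (#|T| <= #|std K N|)%N.
Proof.
move=> idK idP KP vi.
have /choice[r rP] i : exists r, K (v i - r) /\ forall b, ini K b -> coef r b = 0.
  by have [r ? ?] := ideal_remainder (v i) idK; exists r.
pose M := \matrix_(i < #|T|, j < #|std K N|)
  coef (r (enum_val i)) (enum_val j : bmultinom n N).
suff /eqP <- : row_free M by apply: rank_leq_col.
rewrite -kermx_eq0; apply/eqP/row_matrixP => i0; rewrite row0.
set u := row i0 _.
have uM : u *m M = 0 by rewrite /u -row_mul mulmx_ker row0.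
pose l i := u 0 (enum_rank i).
suff l0 : forall i, l i = 0.
  by apply/rowP => i; rewrite [RHS]mxE -(enum_valK i); exact: l0.
apply: vi; exists (\sum_i cpsC n (l i) * (v i - r i)).
  apply: ideal_sum => // i; have [_ _ PM] := idP; apply/PM/KP.
  by case: (rP i).
rewrite -sumrB; under eq_bigr do rewrite mulrBr opprB addrC subrK.
move=> b bN; rewrite val_cps_sum fps_sumE.
under eq_bigr do rewrite val_cpsM fpsCM.
have [ib|nib] := pselect (ini K b).
  by rewrite big1// => i _; have [_ ->//] := rP i; rewrite mulr0.
have bS : BMultinom bN \in std K N by rewrite inE; apply/asboolP.
have := congr1 (fun A : 'rV_ _ => A 0 (enum_rank_in bS (BMultinom bN))) uM.
rewrite mxE [RHS]mxE => uE; rewrite -[RHS]uE (reindex (@enum_val T T)); last first.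
  by apply: onW_bij; exact: enum_val_bij.
apply: eq_bigr => i _; rewrite /l enum_valK; congr (_ * _).
by rewrite mxE enum_rankK_in.
Qed.

Lemma chain_card K s c : ideal K -> prime_chain s c -> K `<=` c 0 ->
  exists C, forall k, (k ^ s <= #|std K (1 + C * k)|)%N.
Proof.
move=> idK pc Kc; have [C H] := chain_indep pc; exists C => k.
have [T [<- [v vi]]] := H k; apply: indep_card vi => //.
by have [/(_ 0 isT)[]] := pc.
Qed.

(** A witness [k] above [B * (1 + C) ^ d] makes [k ^ d.+1] exceed the right-hand side. *)
Lemma expn_growth s d B C : (forall k, (k ^ s <= B * (1 + C * k) ^ d)%N) -> (s <= d)%N.
Proof.
move=> H; rewrite leqNgt; apply/negP => ds.
pose k := (B * (1 + C) ^ d).+1; have := H k; apply/negP; rewrite -ltnNge.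
apply: (@leq_ltn_trans (B * ((1 + C) * k) ^ d)).
  rewrite leq_mul2l; apply/orP; right; case: (d) => // d0; rewrite leq_exp2r//.
  by rewrite mulnDl mul1n leq_add2r.
rewrite expnMn mulnA; apply: (@leq_trans (k * k ^ d)).
  by rewrite ltn_pmul2r// expn_gt0.
by rewrite -expnS leq_pexp2l.
Qed.

End Dimension.

(** * Pivot and free variables *)

Section Pivots.
Variables (R : realType) (n : nat) (K : set (cps R n)).
Hypotheses (idK : ideal K) (K1 : ~ K 1).
Implicit Types (f g h : cps R n) (a b m : multinom n).

Lemma ini_up a b : ini K a -> lem a b -> ini K b.
Proof.
move=> [f Kf fa] ab; exists (cpsX R (mnm_sub b a) * f).
  by have [_ _ KM] := idK; apply: KM.
have bi : initial (cpsX R (mnm_sub b a)) (mnm_sub b a).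
  split=> [|m mb]; first by rewrite /= /fpsX eqxx oner_eq0.
  by rewrite /= /fpsX lt_eqF.
by have := initialM bi fa; rewrite submK.
Qed.

Lemma ini_neq0 a : ini K a -> a != mnm0.
Proof.
move=> [f Kf [fa _]]; apply/eqP => a0; move: fa.
by rewrite a0 (proper_ideal_coef0 idK K1 Kf) eqxx.
Qed.

Definition pivot : {set 'I_n} := [set j | `[< ini K (mnm1 j) >]].
Definition free : {set 'I_n} := ~: pivot.

Lemma pivotP j : reflect (ini K (mnm1 j)) (j \in pivot).
Proof. by rewrite inE; apply: asboolP. Qed.

Definition off_pivots f := forall m, coef f m != 0 -> forall j, j \in pivot -> m j = 0%N.

(** This is the condition through which regularity and the manifold property are compared. *)
Definition off_pivots_free := forall g, K g -> off_pivots g -> g = 0.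

Lemma off_remainder f : exists2 r, K (f - r) & off_pivots r.
Proof.
have [r Kr r0] := ideal_remainder f idK; exists r => // m + j /pivotP Kj.
apply: contraNeq => mj; apply/eqP/r0/(ini_up Kj).
by rewrite lep1mP.
Qed.

Lemma off_pivots_sub f g : off_pivots f -> off_pivots g -> off_pivots (f - g).
Proof.
move=> fo go m; rewrite val_cpsB fpsB => fg j jp.
have [f0|/fo] := eqVneq (coef f m) 0; last exact.
by apply: go jp; move: fg; rewrite f0 sub0r oppr_eq0.
Qed.

Lemma off_pivotsM f g : off_pivots f -> off_pivots g -> off_pivots (f * g).
Proof.
move=> fo go m fg j jp; apply/eqP; apply: contraNT fg => mj.
rewrite val_cpsM fpsM big1// => k km.
have [->|/fo/(_ _ jp) k0] := eqVneq (coef f k) 0; first by rewrite mul0r.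
have [->|/go/(_ _ jp)] := eqVneq (coef g (mnm_sub m k)) 0; first by rewrite mulr0.
by rewrite mnmBE k0 subn0 => mj0; rewrite mj0 eqxx in mj.
Qed.

Lemma off_pivotsD f g : off_pivots f -> off_pivots g -> off_pivots (f + g).
Proof.
move=> fo go m; rewrite val_cpsD fpsD => fg j jp.
have [f0|/fo] := eqVneq (coef f m) 0; last exact.
by apply: go jp; move: fg; rewrite f0 add0r.
Qed.

Lemma off_pivotsC (c : R) : off_pivots (cpsC n c).
Proof.
move=> m; rewrite /= /fpsC; case: (m =P mnm0) => [-> _ j _|_]; last by rewrite eqxx.
by rewrite mnm0E.
Qed.

Lemma off_pivotsU l : l \in free -> off_pivots (cpsU R l).
Proof.
rewrite inE => lf m; rewrite /= /fpsX; case: (m =P mnm1 l) => [-> _ j jp|_]; last by rewrite eqxx.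
by rewrite mnm1E; case: (l =P j) => // lj; rewrite lj jp in lf.
Qed.

(** Remainders of the variables do the work of the implicit function theorem. A free variable keeps
    itself as its solution, so that substituting [G] fixes series in the free variables. *)
Lemma pivot_solutions : exists G : 'I_n -> cps R n,
  [/\ forall j, K (cpsU R j - G j), forall j, off_pivots (G j)
    & forall j, j \in free -> G j = cpsU R j].
Proof.
have /choice[G GP] j : exists g, [/\ K (cpsU R j - g), off_pivots g &
    j \in free -> g = cpsU R j].
  have [jf|jf] := boolP (j \in free); last first.
    by have [r ? ?] := off_remainder (cpsU R j); exists r.
  exists (cpsU R j); split=> //; last exact: off_pivotsU.
  by rewrite subrr; case: idK.
by exists G; split=> j; case: (GP j).
Qed.

Variable G : 'I_n -> cps R n.
Hypotheses (KG : forall j, K (cpsU R j - G j)) (Goff : forall j, off_pivots (G j))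
  (Gfree : forall j, j \in free -> G j = cpsU R j).

Lemma coef0_K f : K f -> coef f mnm0 = 0.
Proof. exact: proper_ideal_coef0. Qed.

Lemma coef_cpsU j m : coef (cpsU R j) m = (m == mnm1 j)%:R. Proof. by []. Qed.

Lemma coef0_G j : coef (G j) mnm0 = 0.
Proof.
have := coef0_K (KG j); rewrite val_cpsB fpsB coef_cpsU eq_sym mnm1_eq0 sub0r.
by move/eqP; rewrite oppr_eq0 => /eqP.
Qed.

(* The linear part of [f] in the free variables, after substitution of [G] for
   the pivot variables. *)
Definition lin_free f l : R := \sum_j coef f (mnm1 j) * coef (G j) (mnm1 l).

(* An element of K with linear part in the free variables only has linear part 0,
   for otherwise its initial exponent would be a free variable. *)
Lemma lin_free_K f l : K f -> lin_free f l = 0.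
Proof.
move=> Kf; pose f' := f - \sum_j cpsC n (coef f (mnm1 j)) * (cpsU R j - G j).
have Kf' : K f'.
  by apply: idealB => //; apply: ideal_sum => // j; have [_ _ KM] := idK; exact: KM.
have f'E i : coef f' (mnm1 i) = lin_free f i.
  rewrite /f' val_cpsB fpsB val_cps_sum fps_sumE.
  under eq_bigr do rewrite val_cpsM fpsCM val_cpsB fpsB coef_cpsU mulrBr.
  rewrite sumrB [X in _ - (X - _)](bigD1 i)//= eqxx mulr1 big1 => [|j ji].
    by rewrite addr0 opprB addrC subrK.
  by rewrite eq_mnm1 eq_sym (negbTE ji) mulr0.
apply/eqP; apply: contrapT => /negP lf.
have [|a [fa al]] := @initial_exists _ _ (f' : fps R n).
  by apply: contraNneq lf => f'0; rewrite -f'E f'0.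
have al1 : (a <= mnm1 l)%O.
  by rewrite leNgt; apply/negP => /al; rewrite f'E => /eqP; apply/negP.
have ini_a : ini K a by exists f'.
(* The initial exponent of [f'] is nonzero and at most [mnm1 l], hence a single variable, which is a
   pivot. No [G j] involves a pivot, so the corresponding coefficient of [f'] is 0. *)
have : (mdeg a <= 1)%N by rewrite -(mdeg1 l) lemc_mdeg.
rewrite leq_eqVlt ltnS leqn0 mdeg_eq0 (negbTE (ini_neq0 ini_a)) orbF.
move=> /mdeg1P[i /eqP ai]; move: fa; rewrite ai f'E /lin_free big1 ?eqxx// => j _.
suff -> : coef (G j) (mnm1 i) = 0 by rewrite mulr0.
apply/eqP; apply: contrapT => /negP /Goff /(_ i); rewrite mnm1E eqxx => H.
by have := H (introT (pivotP i) _); rewrite -ai => /(_ ini_a).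
Qed.

Lemma lin_free_free l k : l \in free -> lin_free (cpsU R l) k = (k == l)%:R.
Proof.
move=> lf; rewrite /lin_free (bigD1 l)// big1 => [|j jl].
  rewrite (Gfree lf) !coef_cpsU !eq_mnm1 eqxx.
  by apply: etrans (addr0 _) (mul1r _).
by rewrite coef_cpsU eq_mnm1 (negbTE jl) mul0r.
Qed.

Lemma lin_free_sum (T : Type) (r : seq T) (F : T -> cps R n) l :
  lin_free (\sum_(i <- r) F i) l = \sum_(i <- r) lin_free (F i) l.
Proof.
rewrite /lin_free exchange_big; apply: eq_bigr => j _ /=.
by rewrite val_cps_sum fps_sumE mulr_suml.
Qed.

Lemma lin_freeD f g l : lin_free (f + g) l = lin_free f l + lin_free g l.
Proof.
by rewrite /lin_free -big_split; apply: eq_bigr => j _; exact: mulrDl.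
Qed.

Lemma coefM1 f g j : coef g mnm0 = 0 ->
  coef (f * g) (mnm1 j) = coef f mnm0 * coef g (mnm1 j).
Proof.
move=> g0; have -> : f * g = cpsC n (coef f mnm0) * g + (f - cpsC n (coef f mnm0)) * g.
  by rewrite -mulrDl addrC subrK.
rewrite val_cpsD fpsD val_cpsM fpsCM; apply/eqP; rewrite -subr_eq0 addrC addKr.
have ord1 (h : cps R n) : coef h mnm0 = 0 -> ordge 1 h.
  by move=> h0 m; rewrite ltnS leqn0 mdeg_eq0 => /eqP ->.
apply/eqP; rewrite val_cpsM (ordgeM (ord1 _ _) (ord1 _ g0)) ?mdeg1//.
by rewrite val_cpsB fpsB /= /fpsC eqxx subrr.
Qed.

Lemma lin_freeM f g l : coef g mnm0 = 0 ->
  lin_free (f * g) l = coef f mnm0 * lin_free g l.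
Proof.
move=> g0; rewrite /lin_free mulr_sumr; apply: eq_bigr => j _.
by rewrite coefM1// mulrA.
Qed.

(** Taking linear parts in the free variables kills [K] and turns the expressions of the free
    variables through the [z i] into a factorization [A *m B] of the identity matrix through
    dimension [d]. *)
Lemma card_free_le (d : nat) (z : 'I_d -> cps R n) : (forall i, coef (z i) mnm0 = 0) ->
  (forall l, l \in free -> exists a : 'I_d -> cps R n, K (cpsU R l - \sum_i a i * z i)) ->
  (#|free| <= d)%N.
Proof.
move=> z0 gen.
have /choice[a aP] (l : 'I_#|free|) : exists a : 'I_d -> cps R n,
    K (cpsU R (enum_val l) - \sum_i a i * z i) by apply/gen/enum_valP.
pose A : 'M[R]_(#|free|, d) := \matrix_(l, i) coef (a l i) mnm0.
pose B : 'M[R]_(d, #|free|) := \matrix_(i, k) lin_free (z i) (enum_val k).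
apply: (@mulmx1_min _ _ _ A B); apply/matrixP => l k; rewrite !mxE.
have := lin_free_K (enum_val k) (aP l); set s := \sum_i _ => E.
transitivity (lin_free s (enum_val k)).
  rewrite lin_free_sum; apply: eq_bigr => i _; by rewrite !mxE lin_freeM.
have := lin_freeD (cpsU R (enum_val l) - s) s (enum_val k).
rewrite subrK E add0r => <-; rewrite lin_free_free ?enum_valP//.
by rewrite (inj_eq enum_val_inj) eq_sym.
Qed.

Lemma std_off N (b : bmultinom n N) j : b \in std K N -> j \in pivot -> b j = 0%N.
Proof.
rewrite inE => /asboolP nb /pivotP Kj; apply/eqP; apply: contrapT => /negP bj.
by apply/nb/(ini_up Kj); rewrite lep1mP.
Qed.

Lemma bmultinom_lt N (b : bmultinom n N) j : (b j < N)%N.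
Proof. by apply: leq_ltn_trans (bmdeg b); rewrite mdegE (bigD1 j)//= leq_addr. Qed.

Lemma card_std N : (0 < N)%N -> (#|std K N| <= N ^ #|free|)%N.
Proof.
case: N => // N _.
pose D := {i : 'I_n | i \in free}.
pose r (b : bmultinom n N.+1) : {ffun D -> 'I_N.+1} := [ffun i => inord (b (val i))].
have -> : (N.+1 ^ #|free| = #|{ffun D -> 'I_N.+1}|)%N.
  by rewrite card_ffun card_ord card_sig.
apply: (@leq_card_in _ _ r) => b c bS cS /ffunP bc.
apply/eqP; rewrite bmeqP; apply/eqP/mnmP => j.
have [jf|] := boolP (j \in free); last first.
  by rewrite inE negbK => jp; rewrite (std_off bS jp) (std_off cS jp).
have := bc (exist _ j jf); rewrite !ffunE => /(congr1 val) /=.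
by rewrite !inordK// bmultinom_lt.
Qed.

(** A standard monomial is not divisible by the initial monomial [a] of [g], so some exponent [b l]
    is below [a l], and [l] is free because [g] is off the pivots. For fixed [l] there are [a l]
    values of [b l] and at most [N] for each other free exponent. *)
Lemma card_std_lt g a N : K g -> off_pivots g -> initial g a -> (0 < N)%N ->
  (#|std K N| <= (\sum_(l in free) a l) * N ^ #|free|.-1)%N.
Proof.
case: N => // N Kg goff ga _.
have Ka : ini K a by exists g.
pose S l := [set b in std K N.+1 | b l < a l]%N.
apply: (@leq_trans (\sum_(l in free) #|S l|)).
  rewrite -sum1_card; under [leqRHS]eq_bigr do rewrite -sum1_card.
  rewrite (exchange_big_dep (mem (std K N.+1)))/=; last first.
    by move=> l b _; rewrite inE => /andP[].
  apply: leq_sum => b bS; have nba : ~~ lem a b.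
    by move: bS; rewrite inE => /asboolP nb; apply/negP => /(ini_up Ka).
  have [l ll] : exists l, (b l < a l)%N.
    apply: contrapT => nl; move/negP: nba; apply; apply/mnm_lepP => l.
    by rewrite leqNgt; apply/negP => ?; apply: nl; exists l.
  have lf : l \in free.
    rewrite inE; apply/negP => lp; have [ga0 _] := ga.
    by move: ll; rewrite (goff _ ga0 _ lp).
  by rewrite (bigD1 l) ?leq_addr//= lf inE bS.
rewrite big_distrl; apply: leq_sum => l lf /=.
have [al0|al0] := posnP (a l).
  rewrite al0 mul0n leqn0 cards_eq0; apply/eqP/setP => b.
  by rewrite !inE al0 ltn0 andbF.
pose D := {i : 'I_n | i \in (free :\ l)%SET}.
pose r (b : bmultinom n N.+1) : 'I_(a l) * {ffun D -> 'I_N.+1} :=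
  (insubd (Ordinal al0) (b l), [ffun i => inord (b (val i))]).
have -> : (a l * N.+1 ^ #|free|.-1 = #|{: 'I_(a l) * {ffun D -> 'I_N.+1}}|)%N.
  by rewrite card_prod card_ffun !card_ord card_sig (cardsD1 l free) lf.
apply: (@leq_card_in _ _ r) => b c; rewrite !inE => /andP[bS bl] /andP[cS cl].
case=> blc /ffunP bc.
have inS (x : bmultinom n N.+1) : `[< ~ ini K x >] -> x \in std K N.+1.
  by move=> nKx; rewrite /std finset.in_set.
apply/eqP; rewrite bmeqP; apply/eqP/mnmP => j.
have [->|jl] := eqVneq j l.
  by move/(congr1 val): blc; rewrite !val_insubd bl cl.
have [jf|] := boolP (j \in free); last first.
  by rewrite inE negbK => jp; rewrite (std_off (inS _ bS) jp) (std_off (inS _ cS) jp).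
have jD : j \in (free :\ l)%SET by rewrite in_setD1 jl.
have := bc (exist _ j jD); rewrite !ffunE => /(congr1 val) /=.
by rewrite !inordK// bmultinom_lt.
Qed.

Lemma chain_le_free s c : prime_chain s c -> K `<=` c 0 -> (s <= #|free|)%N.
Proof.
move=> pc Kc; have [C H] := chain_card idK pc Kc.
apply: (@expn_growth _ _ 1 C) => k; rewrite mul1n.
by apply: leq_trans (H k) (card_std _).
Qed.

(** A nonzero element of [K] off the pivots would lower the growth exponent of the standard
    monomials by one, leaving no room for a chain of length [#|free|]. Its initial exponent also
    provides a free variable, so that the predecessor of [#|free|] is a genuine decrease. *)
Lemma chain_off_pivots_free s c : prime_chain s c -> K `<=` c 0 -> (#|free| <= s)%N ->
  off_pivots_free.
Proof.
move=> pc Kc fs g Kg goff; apply: contrapT => g0.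
have [|a ga] := @initial_exists _ _ (g : fps R n).
  by apply/eqP => g0'; apply: g0; apply: val_inj.
have a0 : a != mnm0 by apply: ini_neq0; exists g.
have [l lf] : exists l, l \in free.
  move: a0; rewrite -mdeg_eq0 mdegE sum_nat_eq0 negb_forall => /existsP[l /= al].
  exists l; rewrite inE; apply/negP => lp; move: al.
  by have [ga0 _] := ga; rewrite (goff _ ga0 _ lp) eqxx.
have [C H] := chain_card idK pc Kc.
have : (s <= #|free|.-1)%N.
  apply: (@expn_growth _ _ (\sum_(l in free) a l) C) => k.
  by apply: leq_trans (H k) (card_std_lt Kg goff ga _).
have : (0 < #|free|)%N by apply/card_gt0P; exists l.
by move: fs; lia.
Qed.

End Pivots.

(** * Regularity of the quotient ring *)

Section RegularQuotient.
Variables (R : realType) (n : nat) (K : set (cps R n)).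
Hypotheses (idK : ideal K) (K1 : ~ K 1).
Variables (A : comNzRingType) (pr : {rmorphism cps R n -> A}).
Hypotheses (pr_surj : forall a, exists f, pr f = a) (pr_ker : forall f, pr f = 0 <-> K f).
Implicit Types (f g h : cps R n) (m : multinom n) (J P : set A).

Lemma pr_eq f g : pr f = pr g <-> K (f - g).
Proof.
rewrite -pr_ker rmorphB; split=> [->|/eqP]; first by rewrite subrr.
by rewrite subr_eq0 => /eqP.
Qed.

Definition quot_max : set A := [set a | exists2 f, coef f mnm0 = 0 & pr f = a].

Lemma quot_maxP f : quot_max (pr f) <-> coef f mnm0 = 0.
Proof.
split=> [[g g0 /pr_eq Kgf]|]; last by exists f.
have := proper_ideal_coef0 idK K1 Kgf; rewrite val_cpsB fpsB g0 sub0r.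
by move/eqP; rewrite oppr_eq0 => /eqP.
Qed.

Lemma quot_proper_sub_max J : ideal J -> ~ J 1 -> J `<=` quot_max.
Proof.
move=> [_ _ JM] J1 a Ja; have [f fa] := pr_surj a; rewrite -fa; apply/quot_maxP.
apply/eqP; apply: contrapT => /negP /cps_unit[g gf]; apply: J1.
by rewrite -(rmorph1 pr) -gf rmorphM fa; apply: JM.
Qed.

Lemma quot_max_ideal : ideal quot_max.
Proof.
split; first by exists 0 => //; rewrite rmorph0.
  move=> _ _ [f f0 <-] [g g0 <-]; exists (f + g); last by rewrite rmorphD.
  by rewrite val_cpsD fpsD f0 g0 addr0.
move=> a _ [f f0 <-]; have [g <-] := pr_surj a; exists (g * f); last by rewrite rmorphM.
by rewrite val_cpsM coef0M f0 mulr0.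
Qed.

Lemma coef0_1 : coef (1 : cps R n) mnm0 = 1.
Proof. by apply: etrans (fps1 R (@mnm0 n)) _; rewrite eqxx. Qed.

Lemma quot_max1 : ~ quot_max 1.
Proof. by rewrite -(rmorph1 pr) quot_maxP coef0_1 => /eqP; rewrite oner_eq0. Qed.

Lemma quot_max_maximal : maximal_ideal quot_max.
Proof.
split; [exact: quot_max_ideal|exact: quot_max1|].
by move=> J idJ J1 MJ; apply/seteqP; split=> //; apply: quot_proper_sub_max.
Qed.

Lemma quot_max_unique M : maximal_ideal M -> M = quot_max.
Proof.
move=> [idM M1 Mmax]; apply/esym/Mmax; [exact: quot_max_ideal|exact: quot_max1|].
exact: quot_proper_sub_max.
Qed.

Lemma preimage_ideal J : ideal J -> ideal (pr @^-1` J).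
Proof.
move=> [J0 JD JM]; split; first by rewrite /preimage /= rmorph0.
  by move=> f g Jf Jg; rewrite /preimage /= rmorphD; apply: JD.
by move=> f g Jg; rewrite /preimage /= rmorphM; apply: JM.
Qed.

Lemma sub_preimage J : ideal J -> K `<=` pr @^-1` J.
Proof. by move=> [J0 _ _] f /pr_ker pf; rewrite /preimage /= pf. Qed.

Lemma preimage_chain s c : prime_chain s c -> prime_chain s (fun i => pr @^-1` c i).
Proof.
move=> [pc lc]; split=> i si.
  have [idP P1 Pp] := pc i si; split; first exact: preimage_ideal.
    by rewrite /preimage /= rmorph1.
  by move=> f g; rewrite /preimage /= rmorphM => /Pp.
have [ci /existsNP[a /not_implyP[ca nca]]] := lc i si; split=> [f|]; first exact: ci.
by have [f fa] := pr_surj a; move=> /(_ f); rewrite /preimage /= fa => /(_ ca).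
Qed.

Lemma quot_noetherian : noetherian A.
Proof.
move=> J idJ; have [s sE] := cps_noetherian (preimage_ideal idJ).
exists [seq pr f | f <- s]; apply/seteqP; split=> [a|a].
  have [f <-] := pr_surj a => Jf.
  have : ideal_span [set` s] f by rewrite -sE.
  have idS := ideal_span_ideal [set` [seq pr f | f <- s]].
  move=> /(_ _ (conj (preimage_ideal idS) _)); apply => g gs.
  by apply: sub_ideal_span => /=; apply: map_f.
move=> Sa; apply: Sa; split=> // _ /mapP[f fs ->].
suff : (pr @^-1` J) f by [].
by rewrite sE; apply: sub_ideal_span.
Qed.

Lemma ideal_span_comb (d : nat) (x : 'I_d -> A) a : ideal_span (range x) a ->
  exists y : 'I_d -> A, a = \sum_i y i * x i.
Proof.
move=> Sa; apply: (Sa [set a | exists y : 'I_d -> A, a = \sum_i y i * x i]).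
split; first split.
- by exists (fun=> 0); rewrite big1// => i _; rewrite mul0r.
- move=> _ _ [y ->] [z ->]; exists (fun i => y i + z i).
  by rewrite -big_split; apply: eq_bigr => i _; rewrite mulrDl.
- move=> b _ [y ->]; exists (fun i => b * y i).
  by rewrite mulr_sumr; apply: eq_bigr => i _; rewrite mulrA.
- move=> _ [i _ <-]; exists (fun j => (j == i)%:R).
  rewrite (bigD1 i)//= eqxx mul1r big1 ?addr0// => j /negbTE ->.
  by rewrite mul0r.
Qed.

(** Lifts of [d] generators of the maximal ideal show that there are at most [d] free variables,
    while a prime chain of length [d] pulls back to one above [K]. Together these are the hypotheses
    of [chain_off_pivots_free]. *)
Lemma regular_off_pivots_free : regular_local_ring A -> off_pivots_free K.
Proof.
move=> [_ [M [d [maxM _ [[c pc] cd] [x ME]]]]].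
have [G [KG Goff Gfree]] := pivot_solutions idK.
have {}maxM := quot_max_unique maxM.
have /choice[z zP] i : exists z, coef z mnm0 = 0 /\ pr z = x i.
  have : quot_max (x i) by rewrite -maxM ME; apply: sub_ideal_span; exists i.
  by case=> z; exists z.
have fd : (#|free K| <= d)%N.
  apply: (card_free_le idK K1 KG Goff Gfree (z := z)) => [i|l _]; first by case: (zP i).
  have : quot_max (pr (cpsU R l)).
    by apply/quot_maxP; rewrite coef_cpsU eq_sym mnm1_eq0.
  rewrite -maxM ME => /ideal_span_comb[y yE].
  have /choice[a aP] i := pr_surj (y i); exists a; apply/pr_eq; rewrite yE rmorph_sum.
  by apply: eq_bigr => i _; rewrite rmorphM aP; have [_ ->] := zP i.
have [pc0 _] := pc; have [id0 _ _] := pc0 0 isT.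
exact: (chain_off_pivots_free idK K1 (preimage_chain pc) (sub_preimage id0) fd).
Qed.

Hypothesis K_free : off_pivots_free K.

Lemma off_pivots_inj f g : off_pivots K f -> off_pivots K g -> pr f = pr g -> f = g.
Proof.
move=> fo go /pr_eq Kfg; apply/eqP; rewrite -subr_eq0; apply/eqP.
by apply: K_free => //; apply: off_pivots_sub.
Qed.

Lemma off_pivots_repr a : exists2 g, off_pivots K g & pr g = a.
Proof.
have [f <-] := pr_surj a; have [r Kr ro] := off_remainder idK f; exists r => //.
by apply/esym/pr_eq.
Qed.

Definition involves (T : {set 'I_n}) (f : fps R n) :=
  forall m, f m != 0 -> exists2 j, j \in T & m j != 0%N.

(** [rest] sets the variables in [T] to 0. It is multiplicative, its kernel is the ideal in
    question, and formal series form a domain. *)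
Lemma involvesM T (f g : fps R n) : involves T (f * g) -> involves T f \/ involves T g.
Proof.
move=> Tfg; pose Tfree m := [forall j in T, m j == 0%N].
pose rest (h : fps R n) : fps R n := fun m => if Tfree m then h m else 0.
have TfreeM m k : lem k m -> Tfree m = Tfree k && Tfree (mnm_sub m k).
  move=> km; have mE j : m j = (mnm_sub m k j + k j)%N by rewrite -mnmDE submK.
  apply/forall_inP/andP => [H|[/forall_inP H1 /forall_inP H2] j jT].
    split; apply/forall_inP => j jT; have := H j jT; rewrite mE addn_eq0;
      by case/andP.
  by rewrite mE (eqP (H1 j jT)) (eqP (H2 j jT)).
have rest0 (h : fps R n) : involves T h <-> rest h = 0.
  split=> [Th|h0 m hm].
    apply/funext => m; rewrite /rest; case: ifP => // /forall_inP Tm.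
    apply/eqP; apply: contrapT => /negP /Th[j /Tm /eqP ->].
    by rewrite eqxx.
  apply: contrapT => nm; have Tm : Tfree m.
    apply/forall_inP => j jT; apply: contrapT => /negP mj; apply: nm.
    by exists j.
  by have := congr1 (fun h : fps R n => h m) h0; rewrite /rest Tm; apply/eqP.
suff /fps_mulf_eq0[/rest0|/rest0] : rest f * rest g = 0 by [left|right].
rewrite -[RHS](iffLR (rest0 _) Tfg); apply/funext => m; rewrite {3}/rest.
rewrite [RHS](_ : _ = \sum_(k : bmultinom n (mdeg m).+1 | lem k m)
    if Tfree m then f k * g (mnm_sub m k) else 0); last first.
  by case: ifP => _; [rewrite fpsM|rewrite big1].
rewrite fpsM; apply: eq_bigr => k km; rewrite (TfreeM _ _ km) /rest.
by case: (Tfree k); case: (Tfree _); rewrite ?mul0r ?mulr0.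
Qed.

(* The ideal generated by the free variables in [T]. *)
Definition coord_prime (T : {set 'I_n}) : set A :=
  [set a | exists g, [/\ off_pivots K g, pr g = a & involves T g]].

Lemma coord_primeP T g : off_pivots K g -> coord_prime T (pr g) <-> involves T g.
Proof.
move=> go; split=> [[h [ho /off_pivots_inj <-//]]|Tg].
by exists g.
Qed.

Lemma involvesD T (f g : fps R n) : involves T f -> involves T g -> involves T (f + g).
Proof.
move=> Tf Tg m; rewrite fpsD; have [->|/Tf //] := eqVneq (f m) 0.
by rewrite add0r => /Tg.
Qed.

Lemma involvesMl T (f g : fps R n) : involves T g -> involves T (f * g).
Proof.
move=> Tg m; rewrite fpsM => fgm; apply: contrapT => nm; move/negP: fgm; apply.
apply/eqP; apply: big1 => k km; have [->|/Tg[j jT]] := eqVneq (g (mnm_sub m k)) 0.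
  by rewrite mulr0.
by rewrite mnmBE => mk; exfalso; apply: nm; exists j => //; lia.
Qed.

(** By [K_free] each class has exactly one representative off the pivots, and these are stable under
    sums and products; primality is then [involvesM]. *)
Lemma coord_prime_prime T : prime_ideal (coord_prime T).
Proof.
have off0 : off_pivots K 0 by move=> m; rewrite eqxx.
split; first split.
- exists 0; split=> //; first by rewrite rmorph0.
  by move=> m; rewrite eqxx.
- move=> _ _ [f [fo <- Tf]] [g [go <- Tg]]; exists (f + g); rewrite rmorphD.
  by split=> //; [exact: off_pivotsD|exact: involvesD].
- move=> a _ [f [fo <- Tf]]; have [g go <-] := off_pivots_repr a.
  by exists (g * f); rewrite rmorphM; split=> //; [exact: off_pivotsM|exact: involvesMl].
- have o1 : off_pivots K 1.
    move=> m; rewrite (_ : fps_of_cps 1 = 1)// fps1; case: (m =P mnm0) => [-> _ j _|_].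
      by rewrite mnm0E.
    by rewrite eqxx.
  rewrite -(rmorph1 pr) (coord_primeP _ o1) => /(_ mnm0).
  rewrite coef0_1 oner_eq0 => /(_ isT)[j _].
  by rewrite mnm0E.
- move=> a b; have [f fo <-] := off_pivots_repr a; have [g go <-] := off_pivots_repr b.
  rewrite -rmorphM (coord_primeP _ (off_pivotsM fo go)) (coord_primeP _ fo).
  by rewrite (coord_primeP _ go); exact: involvesM.
Qed.

(** The upper bound comes from the growth of standard monomials. It is attained by adjoining the
    free variables one at a time: [T i] consists of the first [i] of them, and the variable of index
    [i] makes the step strict. *)
Lemma off_pivots_krull_dim : has_krull_dim A #|free K|.
Proof.
split; last first.
  move=> e c pc; have [pc0 _] := pc; have [id0 _ _] := pc0 0 isT.
  exact: (chain_le_free idK (preimage_chain pc) (sub_preimage id0)).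
pose e := enum (mem (free K)).
pose T i : {set 'I_n} := [set l in free K | (index l e < i)%N].
exists (fun i => coord_prime (T i)); split=> [i _|i ie]; first exact: coord_prime_prime.
have [l lf li] : exists2 l, l \in free K & index l e = i.
  have ie' : (i < size e)%N by rewrite -cardE.
  have [l0 _] : exists l, l \in free K by apply/card_gt0P; apply: leq_ltn_trans ie.
  exists (nth l0 e i); last by rewrite index_uniq// enum_uniq.
  by have := mem_nth l0 ie'; rewrite mem_enum.
split=> [a [g [go <- Tg]]|].
  exists g; split=> // m /Tg[j]; rewrite inE => /andP[jf ji] mj.
  by exists j => //; rewrite inE jf ltnW.
move=> /(_ (pr (cpsU R l))); rewrite !(coord_primeP _ (off_pivotsU lf)) => H.
have /H/(_ (mnm1 l)) : involves (T i.+1) (cpsU R l).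
  move=> m; rewrite coef_cpsU; have [->|_] := eqVneq m (mnm1 l); last by rewrite eqxx.
  by move=> _; exists l; rewrite ?mnm1E ?eqxx// inE lf li ltnSn.
rewrite coef_cpsU eqxx oner_eq0 => /(_ isT)[j]; rewrite inE => /andP[_ ji].
by rewrite mnm1E; have [lj|] := eqVneq l j; rewrite // -lj li ltnn in ji.
Qed.

(** The preimage [L] of the span has every variable among its initial exponents: the pivots because
    [L] contains [K], the free ones as generators. Remainders modulo [L] are therefore constants,
    and a series with constant term 0 has remainder 0. *)
Lemma quot_max_free : quot_max =
  ideal_span (range (fun i : 'I_#|free K| => pr (cpsU R (enum_val i)))).
Proof.
set S := ideal_span _; have idS : ideal S by exact: ideal_span_ideal.
apply/seteqP; split=> [_ [f f0 <-]|a Sa]; last first.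
  apply: Sa; split; first exact: quot_max_ideal.
  by move=> _ [i _ <-]; apply/quot_maxP; rewrite coef_cpsU eq_sym mnm1_eq0.
have idL := preimage_ideal idS; set L := pr @^-1` S in idL.
have L1 : ~ L 1.
  rewrite /L /preimage /= rmorph1 => S1; apply: quot_max1.
  apply: S1; split; first exact: quot_max_ideal.
  by move=> _ [i _ <-]; apply/quot_maxP; rewrite coef_cpsU eq_sym mnm1_eq0.
have [r Lr r0] := ideal_remainder f idL.
have rK m : m != mnm0 -> coef r m = 0.
  move=> m0; apply: r0; have [j mj] : exists j, m j != 0%N.
    by move: m0; rewrite -mdeg_eq0 mdegE sum_nat_eq0 negb_forall => /existsP.
  apply: (@ini_up _ _ _ idL (mnm1 j)); last by rewrite lep1mP.
  have [jf|] := boolP (j \in free K); last first.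
    rewrite inE negbK => /pivotP[g Kg gi]; exists g => //.
    exact: sub_preimage.
  exists (cpsU R j).
    apply: sub_ideal_span; exists (enum_rank_in jf j) => //.
    by rewrite enum_rankK_in.
  split=> [|b bj]; first by rewrite coef_cpsU eqxx oner_eq0.
  by rewrite coef_cpsU lt_eqF.
have r00 : coef r mnm0 = 0.
  have := proper_ideal_coef0 idL L1 Lr; rewrite val_cpsB fpsB f0 sub0r.
  by move/eqP; rewrite oppr_eq0 => /eqP.
suff r_0 : r = 0 by move: Lr; rewrite r_0 subr0.
by apply: cps_eqP => m; have [->|/rK] := eqVneq m mnm0.
Qed.

Lemma off_pivots_free_regular : regular_local_ring A.
Proof.
split; first exact: quot_noetherian.
exists quot_max, #|free K|; split.
- exact: quot_max_maximal.
- exact: quot_max_unique.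
- exact: off_pivots_krull_dim.
- by eexists; exact: quot_max_free.
Qed.

End RegularQuotient.

(** * Analytic functions *)

Section Reexpansion.
Variables (R : realType) (n : nat).
Implicit Types (f g : fps R n) (p x h : 'rV[R]_n) (a b m : multinom n).

Lemma fpsCM_norm x N (c : R) f : p_norm x N (fpsC c * f) = `|c| * p_norm x N f.
Proof.
rewrite /p_norm /psum mulr_sumr; apply: eq_bigr => m _.
by rewrite /fps_abs !fps_termE fpsCM -mulrA normrM.
Qed.

Lemma p_norm_fpsX x N a : p_norm x N (fpsX R a) <= `|mon x a|.
Proof.
have [aN|Na] := ltnP (mdeg a) N; last first.
  rewrite /p_norm /psum big1// => m _.
  rewrite /fps_abs fps_termE /fpsX; case: (_ =P a) => [ma|_]; last by rewrite mul0r normr0.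
  by have := bmdeg m; rewrite ma ltnNge Na.
rewrite /p_norm (@psum_delta _ _ _ _ a)// => [|m /negbTE ma].
  by rewrite /fps_abs fps_termE /fpsX eqxx mul1r.
by rewrite /fps_abs fps_termE /fpsX ma mul0r normr0.
Qed.

Lemma fpsX0 : fpsX R mnm0 = 1 :> fps R n. Proof. by []. Qed.

Lemma p_norm_fpsC x N (c : R) : p_norm x N (@fpsC R n c) <= `|c|.
Proof.
have -> : @fpsC R n c = fpsC c * 1 by rewrite mulr1.
rewrite fpsCM_norm -[leRHS]mulr1 ler_wpM2l// -fpsX0.
by apply: le_trans (p_norm_fpsX _ _ _) _; rewrite mon0 normr1.
Qed.

Lemma p_norm_exp_prod x N (T : Type) (r : seq T) (F : T -> fps R n) (e : T -> nat)
    (c : T -> R) : (forall i, p_norm x N (F i) <= c i) ->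
  p_norm x N (\prod_(i <- r) F i ^+ e i) <= \prod_(i <- r) c i ^+ e i.
Proof.
move=> Fc; have n1 : p_norm x N 1 <= 1.
  by rewrite -fpsX0; apply: le_trans (p_norm_fpsX _ _ _) _; rewrite mon0 normr1.
have c0 i : 0 <= c i by apply: le_trans (Fc i); exact: p_norm_ge0.
have ex i k : p_norm x N (F i ^+ k) <= c i ^+ k.
  elim: k => [|k IH]; first by rewrite !expr0.
  rewrite !exprS; apply: le_trans (p_normM _ _ _ _) _.
  by apply: ler_pM => //; exact: p_norm_ge0.
elim: r => [|i r IH]; first by rewrite !big_nil.
rewrite !big_cons; apply: le_trans (p_normM _ _ _ _) _.
by apply: ler_pM => //; exact: p_norm_ge0.
Qed.

Lemma coef_le_p_norm x N f m : (mdeg m < N)%N -> `|f m| * `|mon x m| <= p_norm x N f.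
Proof.
move=> mN; rewrite /p_norm /psum (bigD1 (BMultinom mN))//=.
rewrite /fps_abs fps_termE normrM lerDl.
by apply: sumr_ge0 => *; exact: normr_ge0.
Qed.

Lemma cvg_sumr (T : Type) (r : seq T) (F : T -> nat -> R) (l : T -> R) :
  (forall i, F i @ \oo --> l i) ->
  (fun N => \sum_(i <- r) F i N) @ \oo --> \sum_(i <- r) l i.
Proof.
move=> Fl; elim: r => [|i r IH].
  by rewrite big_nil; under eq_fun do rewrite big_nil; exact: cvg_cst.
by rewrite big_cons; under eq_fun do rewrite big_cons; exact: cvgD.
Qed.

(* Completeness for the weighted l^1 norm, [a] controlling the Cauchy sequence. *)
Lemma p_norm_complete x (S : nat -> fps R n) (a : nat -> R) (L : R) :
  (forall i, 0 < x 0 i) -> nondecreasing_seq a -> a @ \oo --> L ->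
  (forall N N' M, (N <= N')%N -> p_norm x M (S N' - S N) <= a N' - a N) ->
  exists s : fps R n, forall N M, p_norm x M (s - S N) <= L - a N.
Proof.
move=> x0 nda aL SC.
have xm m : 0 < mon x m by exact: mon_gt0.
have coefS N N' m : (N <= N')%N -> `|S N' m - S N m| <= (a N' - a N) / mon x m.
  move=> NN; rewrite ler_pdivlMr// -{1}(gtr0_norm (xm m)).
  apply: le_trans (SC _ _ (mdeg m).+1 NN).
  by apply: (@coef_le_p_norm _ _ (S N' - S N)).
have aL' N : a N <= L.
  have <- : limn a = L by exact/cvg_lim.
  by apply: nondecreasing_cvgn_le => //; apply/cvg_ex; exists L.
have cS m : cvgn (fun N => S N m).
  (* Adding the control sequence, scaled by the monomial, makes the coefficients nondecreasing in
     [N], so they converge by boundedness. *)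
  have -> : (fun N => S N m) = (fun N => S N m + a N / mon x m) - (fun N => a N / mon x m).
    by apply/funext => N; rewrite !fctE addrK.
  have ca : cvgn (fun N => a N / mon x m).
    by apply: is_cvgMl; apply/cvg_ex; exists L.
  apply: is_cvgB => //; apply: nondecreasing_is_cvgn.
    move=> N N' NN; have := coefS _ _ m NN; rewrite ler_norml => /andP[+ _].
    by rewrite mulrBl; lra.
  exists (S 0 m + (L - a 0) / mon x m + L / mon x m) => _ [N _ <-].
  apply: lerD; last by rewrite ler_wpM2r// invr_ge0 ltW.
  have := coefS 0 N m (leq0n _); rewrite ler_norml => /andP[_].
  rewrite lerBlDl => /le_trans; apply; rewrite lerD2l ler_wpM2r// ?invr_ge0 ?(ltW (xm m))//.
  by rewrite lerD2r.
exists (fun m => limn (fun N => S N m)) => N M.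
have cN : (fun N' => p_norm x M (S N' - S N)) @ \oo -->
    p_norm x M ([the fps R n of fun m => limn (fun N => S N m)] - S N).
  rewrite /p_norm /psum; apply: cvg_sumr => m.
  rewrite /fps_abs; apply: cvg_norm.
  apply: cvgM; last exact: cvg_cst.
  by apply: cvgB; [exact: cS|exact: cvg_cst].
have cL : (fun N' => a N' - a N) @ \oo --> L - a N.
  by apply: cvgB => //; exact: cvg_cst.
apply: (ler_cvg_to cN cL); near=> N'; apply: SC.
by near: N'; exact: nbhs_infty_ge.
Unshelve. all: by end_near. Qed.

Definition rowp (s : 'I_n -> 'I_n) x : 'rV[R]_n := \row_i x 0 (s i).

(** The monomial [m] evaluated at [rowp s (p + h)], expanded as a polynomial in [h]. *)
Definition shifted_mon (s : 'I_n -> 'I_n) p m : fps R n :=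
  \prod_i (fpsC (p 0 (s i)) + fpsX R (mnm1 (s i))) ^+ m i.

Lemma fps_sum_exp_prod x (T : Type) (r : seq T) (F : T -> fps R n) (e : T -> nat) :
  (forall i, abs_converges (F i) x) ->
  abs_converges (\prod_(i <- r) F i ^+ e i) x /\
  fps_sum (\prod_(i <- r) F i ^+ e i) x = \prod_(i <- r) fps_sum (F i) x ^+ e i.
Proof.
move=> Fx; have ex i k : abs_converges (F i ^+ k) x /\
    fps_sum (F i ^+ k) x = fps_sum (F i) x ^+ k.
  elim: k => [|k [cF IH]]; first by rewrite !expr0 fps_sum1; split=> //; exact: abs_converges1.
  by rewrite !exprS fps_sumM// IH; split=> //; exact: abs_convergesM.
elim: r => [|i r [cr IH]].
  by rewrite !big_nil fps_sum1; split=> //; exact: abs_converges1.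
have [ci Ei] := ex i (e i).
by rewrite !big_cons fps_sumM// IH Ei; split=> //; exact: abs_convergesM.
Qed.

Lemma abs_converges_fpsC (c : R) x : abs_converges (@fpsC R n c) x.
Proof. exact: supported_lt_abs_converges (@fpsC_supported _ _ _). Qed.

Lemma abs_converges_fpsX a x : abs_converges (fpsX R a) x.
Proof. exact: supported_lt_abs_converges (@fpsX_supported _ _ _). Qed.

Lemma fps_sum_big x (T : Type) (r : seq T) (F : T -> fps R n) :
  (forall i, abs_converges (F i) x) ->
  abs_converges (\sum_(i <- r) F i) x /\
  fps_sum (\sum_(i <- r) F i) x = \sum_(i <- r) fps_sum (F i) x.
Proof.
move=> Fx; elim: r => [|i r [cr IH]].
  by rewrite !big_nil fps_sum0; split=> //; exact: abs_converges0.
by rewrite !big_cons fps_sumD// IH; split=> //; exact: abs_convergesD.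
Qed.

Lemma shifted_mon_sum s p m h : abs_converges (shifted_mon s p m) h /\
  fps_sum (shifted_mon s p m) h = mon (rowp s (p + h)) m.
Proof.
have ci i : abs_converges (fpsC (p 0 (s i)) + fpsX R (mnm1 (s i)) : fps R n) h.
  by apply: abs_convergesD; [exact: abs_converges_fpsC|exact: abs_converges_fpsX].
have [cm ->] := fps_sum_exp_prod (index_enum _) m ci; split=> //.
rewrite /mon; apply: eq_bigr => i _; rewrite !mxE fps_sumD.
- by rewrite fps_sumC fps_sumX mon1.
- exact: abs_converges_fpsC.
- exact: abs_converges_fpsX.
Qed.

(** With [|p_i| + d <= r], each monomial expanded at [p] has norm at radius [d] at most its value at
    radius [r]. The expanded partial sums are thus Cauchy, controlled by those of [f] at [r]. The
    map [s] covers the coordinate permutation in the inverse chart. *)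
Lemma analytic_reexpansion f (r : R) (s : 'I_n -> 'I_n) p : 0 < r ->
  abs_converges f (const_mx r) -> (forall i, `|p 0 (s i)| < r) ->
  analytic_at (fun x => fps_sum f (rowp s x)) p.
Proof.
move=> r0 fr pr.
have [d d0 dr] : exists2 d : R, 0 < d & forall i, d <= r - `|p 0 (s i)|.
  by apply: min_pos_family => i; rewrite subr_gt0.
pose S N : fps R n := \sum_(m : bmultinom n N) fpsC (f m) * shifted_mon s p m.
pose a N := p_norm (const_mx r) N f.
have SE N k : S N k = psum N (fun m => f m * shifted_mon s p m k).
  by rewrite /S fps_sumE; apply: eq_bigr => m _; rewrite fpsCM.
have smn M m : p_norm (const_mx d) M (shifted_mon s p m) <= mon (const_mx r) m.
  apply: (@le_trans _ _ (\prod_i (`|p 0 (s i)| + d) ^+ m i)).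
    apply: p_norm_exp_prod => i; apply: le_trans (p_normD _ _ _ _) _.
    apply: lerD; first exact: p_norm_fpsC.
    by apply: le_trans (p_norm_fpsX _ _ _) _; rewrite mon1 mxE gtr0_norm.
  rewrite /mon; apply: ler_prod => i _; rewrite exprn_ge0 ?addr_ge0 ?(ltW d0)//=.
  by rewrite mxE lerXn2r// ?nnegrE ?addr_ge0 ?(ltW d0) ?(ltW r0)// -lerBrDl.
have SC N N' M : (N <= N')%N -> p_norm (const_mx d) M (S N' - S N) <= a N' - a N.
  move=> NN; pose f' : fps R n := f - fps_cut N f.
  have -> : S N' - S N = \sum_(m : bmultinom n N') fpsC (f' m) * shifted_mon s p m.
    apply/funext => k; rewrite fpsB !SE -(psum_cut _ NN) fps_sumE /psum -sumrB.
    apply: eq_bigr => m _; rewrite fpsCM /f' fpsB /fps_cut mulrBl.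
    by case: ifP; rewrite ?mul0r.
  apply: le_trans (p_norm_sum _ _ _ _) _.
  apply: (@le_trans _ _ (\sum_(m : bmultinom n N') `|f' m| * mon (const_mx r) m)).
    by apply: ler_sum => m _; rewrite fpsCM_norm ler_wpM2l.
  rewrite /a /p_norm -[X in _ - X](psum_cut _ NN) /psum -sumrB.
  apply: ler_sum => m _; rewrite /f' fpsB /fps_cut /fps_abs !fps_termE !normrM.
  have rm : `|mon (const_mx r) m| = mon (const_mx r) m.
    by rewrite mon_const ger0_norm// exprn_ge0// ltW.
  by rewrite rm; case: ifP => _; rewrite ?subrr ?subr0 ?normr0 ?mul0r.
have ba : fps_bounded (fps_term f (const_mx r)) by apply/summable_fps.
have aL : a @ \oo --> limn a by exact: fps_bounded_cvg_abs.
have nda : nondecreasing_seq a by apply: psum_nd => m; exact: normr_ge0.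
have x0 i : 0 < (const_mx d : 'rV[R]_n) 0 i by rewrite mxE.
have [t tP] := p_norm_complete x0 nda aL SC.
have S0 : S 0%N = 0.
  by apply/funext => k; rewrite SE /psum big1// => m; have := bmdeg m; rewrite ltn0.
have ct : abs_converges t (const_mx d).
  apply/summable_fps; exists (limn a - a 0%N) => N; have := tP 0%N N.
  by rewrite S0 subr0.
exists (mkcps (iffRL (convergentP t) (ex_intro2 _ _ d d0 ct))).
near=> h; have hd i : `|h 0 i| <= d.
  by apply: ltW; move: i; near: h; exact: near0_le.
have hle i : `|h 0 i| <= `|(const_mx d : 'rV[R]_n) 0 i| by rewrite mxE (gtr0_norm d0).
have cSh N : abs_converges (S N) h /\ fps_sum (S N) h = psum N (fps_term f (rowp s (p + h))).
  have cm m : abs_converges (fpsC (f m) * shifted_mon s p m) h.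
    by apply: abs_convergesM; [exact: abs_converges_fpsC|case: (shifted_mon_sum s p m h)].
  have [c ->] := fps_sum_big (index_enum (bmultinom n N)) cm; split=> //.
  apply: eq_bigr => m _; have [cs sE] := shifted_mon_sum s p m h.
  by rewrite fps_sumM// ?fps_sumC ?sE//; exact: abs_converges_fpsC.
have cth : abs_converges t h by exact: abs_converges_le ct.
have dist N : `|fps_sum t h - fps_sum (S N) h| <= limn a - a N.
  have [cS _] := cSh N; rewrite -fps_sumB//; apply: fps_sum_le => M.
  apply: le_trans (tP N M); apply: le_psum => m.
  by rewrite /fps_abs !fps_termE !normrM ler_wpM2l// ler_norm_mon.
have lim1 : (fun N => fps_sum (S N) h) @ \oo --> fps_sum t h.
  apply/cvgrPdist_le => e e0; near=> N; apply: le_trans (dist N) _.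
  rewrite lerBlDr -lerBlDl; near: N.
  have /cvgrPdist_le/(_ _ e0) := aL; apply: filterS => N.
  by move=> /(le_trans (ler_norm _)); lra.
rewrite /= /fps_sum; apply/cvg_lim => //.
by under eq_fun do rewrite -(cSh _).2.
Unshelve. all: by end_near. Qed.

End Reexpansion.

Section AnalyticFunctions.
Variables (R : realType) (n : nat).
Implicit Types (f g : 'rV[R]_n -> R) (p x y h : 'rV[R]_n).

Lemma near_shift0 (P : set 'rV[R]_n) p :
  (\forall h \near (0 : 'rV[R]_n), P (p + h)) -> \forall x \near p, P x.
Proof.
move=> /nbhs_ballP[e /= e0 eP]; apply/nbhs_ballP; exists e => // x [_ px].
rewrite -[x](subrK p) addrC; apply: eP; split=> // i j; have := px i j.
by rewrite !mxE /ball /= sub0r opprB.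
Qed.

Lemma analytic_atB f g p : analytic_at f p -> analytic_at g p ->
  analytic_at (fun x => f x - g x) p.
Proof.
move=> [s sE] [t tE]; exists (s - t); near=> h.
rewrite val_cpsB fps_sumB; first by congr (_ - _); near: h.
- by near: h; exact: cps_convergent.
- by near: h; exact: cps_convergent.
Unshelve. all: by end_near. Qed.

Lemma analytic_atD f g p : analytic_at f p -> analytic_at g p ->
  analytic_at (fun x => f x + g x) p.
Proof.
move=> [s sE] [t tE]; exists (s + t); near=> h.
rewrite val_cpsD fps_sumD; first by congr (_ + _); near: h.
- by near: h; exact: cps_convergent.
- by near: h; exact: cps_convergent.
Unshelve. all: by end_near. Qed.

Lemma analytic_at_coord i p : analytic_at (fun x => x 0 i) p.
Proof.
exists (cpsC n (p 0 i) + cpsU R i); near=> h.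
rewrite val_cpsD fps_sumD ?fps_sumC ?fps_sumX ?mon1 ?mxE//.
- exact: abs_converges_fpsC.
- exact: abs_converges_fpsX.
Unshelve. all: by end_near. Qed.

Lemma analytic_near f p (r : R) : analytic_at f p -> `|f p| < r ->
  \forall x \near p, `|f x| < r.
Proof.
move=> [s sE] fpr.
have fp : f p = coef s mnm0.
  by have := nbhs_singleton sE; rewrite addr0 fps_sum_at0.
have [e e0 se] := cps_conv s; pose t := s - cpsC n (coef s mnm0).
have te : abs_converges t (const_mx e).
  by apply: abs_converges_sub => //; exact: abs_converges_fpsC.
have t1 : ordge 1 t.
  move=> m; rewrite ltnS leqn0 mdeg_eq0 => /eqP ->.
  by rewrite val_cpsB fpsB /= /fpsC eqxx subrr.
have [C C0 tC] := fps_sum_ordge e0 te t1.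
pose d := Num.min e ((r - `|f p|) / (C + 1)).
have d0 : 0 < d by rewrite lt_min e0 divr_gt0// ?subr_gt0// ltr_wpDl.
apply: near_shift0; near=> h.
have hd i : `|h 0 i| <= d by apply: ltW; move: i; near: h; exact: near0_le.
rewrite (_ : f (p + h) = fps_sum s h); last by near: h.
have sh : abs_converges s h.
  apply: abs_converges_le se => i; rewrite mxE (gtr0_norm e0).
  by apply: le_trans (hd i) _; rewrite ge_min lexx.
have -> : fps_sum s h = fps_sum t h + f p.
  by rewrite fp fps_sumB// ?fps_sumC ?subrK//; exact: abs_converges_fpsC.
apply: le_lt_trans (ler_normD _ _) _.
rewrite -ltrBrDr; apply: (@le_lt_trans _ _ (C * d ^+ 1)).
  by apply: tC hd; [exact: ltW|rewrite ge_min lexx].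
apply: (@lt_le_trans _ _ ((C + 1) * d)).
  by rewrite expr1 ltr_pM2r// ltrDl.
by rewrite mulrC -ler_pdivlMr ?ltr_wpDl// ge_min lexx orbT.
Unshelve. all: by end_near. Qed.

Definition poly_at (G : 'I_n -> cps R n) (F : mpoly n R) : cps R n :=
  \sum_(m <- msupp F) cpsC n (mcoeff m F) * \prod_i G i ^+ m i.

Lemma poly_at_sum (G : 'I_n -> cps R n) (F : mpoly n R) x :
  (forall i, abs_converges (G i) x) ->
  abs_converges (poly_at G F) x /\
  fps_sum (poly_at G F) x = meval (fun i => fps_sum (G i) x) F.
Proof.
move=> Gx; rewrite mevalE /poly_at val_cps_sum.
have cp m := fps_sum_exp_prod (index_enum _) (m : multinom n) Gx.
have vE (m : multinom n) : (cpsC n (mcoeff m F) * \prod_i G i ^+ m i : cps R n) =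
    fpsC (mcoeff m F) * \prod_i (G i : fps R n) ^+ m i :> fps R n.
  rewrite val_cpsM; congr (_ * _).
  apply: etrans (rmorph_prod (val : cps R n -> fps R n) _ _ _) _.
  apply: eq_bigr => i _.
  exact: (rmorphXn (val : cps R n -> fps R n)).
under eq_bigr do rewrite vE.
have cm m : abs_converges (fpsC (mcoeff m F) * \prod_i (G i : fps R n) ^+ m i) x.
  by apply: abs_convergesM; [exact: abs_converges_fpsC|case: (cp m)].
have [c ->] := fps_sum_big (msupp F) cm; split=> //.
apply: eq_bigr => m _; have [cs sE] := cp m.
by rewrite fps_sumM// ?fps_sumC ?sE//; exact: abs_converges_fpsC.
Qed.

Lemma off_pivots_prod K (T : Type) (r : seq T) (G : T -> cps R n) (e : T -> nat) :
  (forall i, off_pivots K (G i)) -> off_pivots K (\prod_(i <- r) G i ^+ e i).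
Proof.
move=> Go; have o1 : off_pivots K 1.
  have -> : (1 : cps R n) = cpsC n 1.
    apply: cps_eqP => m; apply: etrans (fps1 _ _) _.
    by rewrite /= /fpsC; case: eqP.
  exact: off_pivotsC.
elim/big_ind: _ => // [f g|i _]; first exact: off_pivotsM.
elim: (e i) => [//|k IH]; rewrite exprS; exact: off_pivotsM.
Qed.

Lemma off_pivots_poly_at K (G : 'I_n -> cps R n) (F : mpoly n R) :
  (forall i, off_pivots K (G i)) -> off_pivots K (poly_at G F).
Proof.
move=> Go; rewrite /poly_at; elim/big_ind: _ => [m|f g|m _].
- by rewrite eqxx.
- exact: off_pivotsD.
- by apply: off_pivotsM; [exact: off_pivotsC|exact: off_pivots_prod].
Qed.

Lemma fps_sum_off_pivots K (g : cps R n) x y : off_pivots K g ->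
  (forall l, l \in free K -> x 0 l = y 0 l) -> fps_sum g x = fps_sum g y.
Proof.
move=> go xy; congr (limn _); apply/funext => N; apply: eq_bigr => m _.
rewrite !fps_termE; have [->|/go gm] := eqVneq (coef g m) 0; first by rewrite !mul0r.
congr (_ * _); apply: eq_bigr => l _; have [lf|] := boolP (l \in free K).
  by rewrite xy.
by rewrite inE negbK => /gm ->; rewrite !expr0.
Qed.

End AnalyticFunctions.

Section SetToFront.
Variables (n : nat) (F : {set 'I_n}).

(** A chart puts the vanishing coordinates last, so the free variables have to come first. *)
Lemma reorder_set : exists s t : 'I_n -> 'I_n,
  [/\ cancel s t, cancel t s & forall i : 'I_n, (i < #|F|)%N = (s i \in F)].
Proof.
pose e := enum F ++ enum (~: F)%SET.
have eU : uniq e.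
  rewrite cat_uniq !enum_uniq andbT /=; apply/hasPn => i.
  by rewrite !mem_enum inE.
have sE : size e = n by rewrite size_cat -!cardE cardsC card_ord.
have eT i : i \in e by rewrite mem_cat !mem_enum inE orbN.
have ie i : (index i e < n)%N by rewrite -[X in (_ < X)%N]sE index_mem.
exists (fun i => nth i e i), (fun j => Ordinal (ie j)); split=> i.
- by apply: val_inj; rewrite /= index_uniq ?sE.
- by rewrite /= nth_index.
- rewrite nth_cat -cardE; case: ifP => iF.
    by apply/esym; rewrite -(mem_enum F) mem_nth// -cardE.
  apply/esym/negbTE; have := @mem_nth _ i (enum (~: F)%SET) (i - #|F|)%N.
  rewrite mem_enum inE; apply.
  by rewrite -cardE ltn_subLR ?cardsC ?card_ord// leqNgt iF.
Qed.

End SetToFront.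

Section GermIdeal.
Variables (R : realType) (n : nat) (X : set 'rV[R]_n).
Hypothesis X0 : X 0.

Definition germ_set : set (cps R n) := [set f | vanishes_near_origin X f].

Lemma germ_setP f : germ_set f <-> f \in germ_ideal X0.
Proof. by rewrite inE; split. Qed.

Lemma germ_set_ideal : ideal germ_set.
Proof.
have [g0 _ gD] := germ_ideal_closed X0; split; first exact/germ_setP.
  move=> f g /germ_setP fK /germ_setP gK; apply/germ_setP.
  by rewrite -[f]mul1r; exact: gD.
move=> a f /germ_setP fK; apply/germ_setP; rewrite -[_ * _]addr0; exact: gD.
Qed.

Lemma germ_set1 : ~ germ_set 1.
Proof. by move=> /germ_setP; apply/negP; case: (germ_ideal_closed X0). Qed.

End GermIdeal.

(** * Manifold points *)

Section GraphManifold.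
Variables (R : realType) (n : nat) (I : set (mpoly n R)).
Let X := real_zero_set I.
Let K := germ_set X.
Hypothesis X0 : X 0.
Implicit Types (x y z p : 'rV[R]_n).

Let idK : ideal K := germ_set_ideal X0.
Let K1 : ~ K 1 := @germ_set1 _ _ _ X0.

Lemma rowpK (s t : 'I_n -> 'I_n) x : cancel t s -> rowp t (rowp s x) = x.
Proof. by move=> ts; apply/rowP => i; rewrite !mxE ts. Qed.

(* If no nonzero germ of K involves free variables only, then X is near 0 the
   graph of the solutions G of the pivot variables: F(G) is off the pivots and
   lies in K for F in I, hence vanishes identically. *)
Lemma off_pivots_free_manifold : off_pivots_free K -> manifold_point X 0.
Proof.
move=> Kfree; have [G [KG Goff Gfree]] := pivot_solutions idK.
have G0 j : coef (G j) mnm0 = 0 by exact: (coef0_G idK K1 KG j).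
have [r r0 Gr] : exists2 r : R, 0 < r & forall j, abs_converges (G j) (const_mx r).
  have /choice[e eP] j : exists e : R, 0 < e /\ abs_converges (G j) (const_mx e).
    by have [e ? ?] := cps_conv (G j); exists e.
  have [r r0 re] := min_pos_family (fun j => (eP j).1); exists r => // j.
  apply: abs_converges_le (eP j).2 => i; rewrite !mxE !gtr0_norm//.
  by case: (eP j).
(* The germs [x_j - G_j] lie in [K], and there are finitely many of them, so one radius serves for
   all. *)
have [d d0 Xd] : exists2 d : R, 0 < d & forall x, (forall i, `|x 0 i| < d) -> X x ->
    forall j, x 0 j = fps_sum (G j) x.
  have : \forall x \near (0 : 'rV[R]_n), forall j,
      X x -> fps_sum (cpsU R j - G j) x = 0.
    apply: (@filter_forall _ _ (fun j x => X x -> fps_sum (cpsU R j - G j) x = 0)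
      _ (nbhs_filter _)) => j.
    by have := KG j; apply: filterS => x [_].
  move=> /nbhs_ballP[d /= d0 dP]; exists (Num.min d r); first by rewrite lt_min d0.
  move=> x xd Xx j; have xd' i : `|x 0 i| < d /\ `|x 0 i| < r.
    by have := xd i; rewrite lt_min => /andP[].
  have : fps_sum (cpsU R j - G j) x = 0.
    apply: dP => //; split=> // i k; rewrite !mxE /ball /= sub0r normrN (ord1 i).
    by case: (xd' k).
  rewrite val_cpsB fps_sumB ?fps_sumX ?mon1.
  - by move/eqP; rewrite subr_eq0 => /eqP.
  - exact: abs_converges_fpsX.
  - apply: abs_converges_le (Gr j) => i; rewrite mxE (gtr0_norm r0) ltW//.
    by case: (xd' i).
pose e := Num.min d r; have e0 : 0 < e by rewrite lt_min d0.
have ed : e <= d by rewrite ge_min lexx.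
have er : e <= r by rewrite ge_min lexx orbT.
pose box x := forall i, `|x 0 i| < e.
(* [H] depends only on the free coordinates and has free coordinates 0, so subtracting [H] and
   adding [H] are mutually inverse. *)
pose H x : 'rV[R]_n := \row_j (if j \in pivot K then fps_sum (G j) x else 0).
have Hfree x y : (forall l, l \in free K -> x 0 l = y 0 l) -> H x = H y.
  move=> xy; apply/rowP => j; rewrite !mxE; case: ifP => // _.
  exact: fps_sum_off_pivots xy.
have Hl x l : l \in free K -> H x 0 l = 0.
  by rewrite !mxE inE; case: ifP.
have HB x : H (x - H x) = H x.
  apply: Hfree => l lf; have -> : (x - H x) 0 l = x 0 l - H x 0 l by rewrite !mxE.
  by rewrite Hl ?subr0.
have HD x : H (x + H x) = H x.
  apply: Hfree => l lf; have -> : (x + H x) 0 l = x 0 l + H x 0 l by rewrite !mxE.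
  by rewrite Hl ?addr0.
have [s [t [st ts sF]]] := reorder_set (free K).
pose phi x := rowp s (x - H x).
pose psi y := rowp t y + H (rowp t y).
have psiK x : psi (phi x) = x by rewrite /psi /phi (rowpK _ ts) HB subrK.
have phiK y : phi (psi y) = y by rewrite /psi /phi HD addrK (rowpK _ st).
have box_r x i : box x -> `|x 0 i| < r by move=> /(_ i) /lt_le_trans; exact.
have Han x (u : 'I_n -> 'I_n) j : box (rowp u x) ->
    analytic_at (fun x => H (rowp u x) 0 j) x.
  move=> bx; have [jp|jp] := boolP (j \in pivot K).
    rewrite (_ : (fun x => _) = fun x => fps_sum (G j) (rowp u x)).
      apply: (@analytic_reexpansion _ _ _ r) => // i.
      by have := box_r _ i bx; rewrite mxE.
    by apply/funext => z; rewrite mxE jp.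
  (* The zero function is written as a difference of coordinates to obtain its analyticity. *)
  rewrite (_ : (fun x => _) = fun x => x 0 j - x 0 j).
    by apply: analytic_atB; exact: analytic_at_coord.
  by apply/funext => z; rewrite mxE (negbTE jp) subrr.
have rowp_id x : rowp id x = x by apply/rowP => i; rewrite mxE.
have phi_an x j : box x -> analytic_at (fun x => (x - H x) 0 j) x.
  move=> bx; rewrite (_ : (fun x => _) = fun x => x 0 j - H (rowp id x) 0 j).
    by apply: analytic_atB; [exact: analytic_at_coord|apply: Han; rewrite rowp_id].
  by apply/funext => z; rewrite rowp_id !mxE.
have psi_an y j : box (rowp t y) -> analytic_at (fun y => psi y 0 j) y.
  move=> by_; rewrite (_ : (fun y => _) = fun y => y 0 (t j) + H (rowp t y) 0 j).
    by apply: analytic_atD; [exact: analytic_at_coord|exact: Han].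
  by apply/funext => z; rewrite /psi !mxE.
have open_box (P : 'rV[R]_n -> 'rV[R]_n) x :
    (forall i, analytic_at (fun x => P x 0 i) x) -> box (P x) ->
    \forall x' \near x, box (P x').
  move=> Pan bP; apply: (@filter_forall _ _ (fun i x' => `|P x' 0 i| < e) _ (nbhs_filter _)) => i.
  by apply: (analytic_near (f := fun x => P x 0 i)); [exact: Pan|exact: bP].
(* [H] is known to be analytic only on the box. Both conditions are imposed on both sides, so that
   [phi] maps [U] onto [V]. *)
pose U := [set x | box x /\ box (x - H x)].
pose V := [set y | box (rowp t y) /\ box (psi y)].
have H0 : H 0 = 0.
  by apply/rowP => j; rewrite !mxE fps_sum_at0 G0 if_same.
have box0 : box 0 by move=> i; rewrite mxE normr0.
have U0 : U 0 by split; rewrite ?H0 ?subr0.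
have openU : open U.
  rewrite openE => x [bx bHx]; rewrite /interior.
  have h1 : \forall x' \near x, box x'.
    by apply: (open_box id) => // i; exact: analytic_at_coord.
  have h2 : \forall x' \near x, box (x' - H x').
    by apply: (open_box (fun x => x - H x)) => // i; exact: phi_an.
  by apply: filterS2 h1 h2.
have openV : open V.
  rewrite openE => y [by_ bpsi]; rewrite /interior.
  have h1 : \forall y' \near y, box (rowp t y').
    apply: (open_box (rowp t)) => // i.
    rewrite (_ : (fun x => _) = fun x => x 0 (t i)); first exact: analytic_at_coord.
    by apply/funext => z; rewrite mxE.
  have h2 : \forall y' \near y, box (psi y').
    by apply: (open_box psi) => // i; exact: psi_an.
  by apply: filterS2 h1 h2.
have XU x : U x -> (X x <-> forall i : 'I_n, (#|free K| <= i)%N -> phi x 0 i = 0).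
  move=> [bx _]; split=> [Xx i|px f If].
    rewrite leqNgt sF inE negbK => ip; rewrite !mxE ip.
    rewrite -(Xd _ _ Xx) ?subrr// => k; exact: lt_le_trans (bx k) ed.
  have xG j : fps_sum (G j) x = x 0 j.
    have [jf|jp] := boolP (j \in free K).
      by rewrite (Gfree _ jf) fps_sumX mon1.
    have := px (t j); rewrite leqNgt sF ts jp => /(_ isT).
    move: jp; rewrite !mxE ts inE negbK => ->.
    by move/eqP; rewrite subr_eq0 => /eqP.
  have cG z : (forall i, `|z 0 i| < r) -> forall j, abs_converges (G j) z.
    move=> zr j; apply: abs_converges_le (Gr j) => i.
    by rewrite mxE (gtr0_norm r0) ltW.
  (* On [X] near 0 a point equals its image under [G], so [f(G)] vanishes there and lies in [K];
     being off the pivots, it is 0. The identity then holds on the whole box, whose size does not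
     depend on [f]. *)
  have F0 : poly_at G f = 0.
    apply: Kfree; last exact: off_pivots_poly_at.
    have : \forall z \near (0 : 'rV[R]_n), forall i, `|(z : 'rV[R]_n) 0 i| < e.
      exact: near0_le.
    apply: filterS => z zb.
    have [cz zE] := poly_at_sum f (cG z (fun i => lt_le_trans (zb i) er)).
    split=> // Xz; rewrite zE; rewrite -[RHS](Xz f If); apply: meval_eq => j.
    by rewrite (Xd _ _ Xz)// => i; exact: lt_le_trans (zb i) ed.
  have [_] := poly_at_sum f (cG x (fun i => lt_le_trans (bx i) er)).
  rewrite F0 [fps_sum _ _](fps_sum0 x) => F0x; rewrite [RHS]F0x.
  by apply: meval_eq => j; rewrite xG.
split=> //; exists U; split=> //; exists #|free K|.
  by rewrite -[leqRHS]card_ord max_card.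
move=> p [Xp Up]; exists U, V, phi; split=> //.
  split.
    split.
    - move=> x [bx bHx]; split; first by rewrite /phi (rowpK _ ts).
      by rewrite psiK.
    - by move=> x y _ _ pxy; rewrite -(psiK x) pxy psiK.
    - move=> y [by_ bpsi]; exists (psi y); last exact: phiK.
      by split=> //; rewrite /psi HD addrK.
  exists psi; split=> [x _|x [bx _] j|y [by_ _] j]; first exact: psiK.
    rewrite (_ : (fun x => _) = fun x => (x - H x) 0 (s j)); first exact: phi_an.
    by apply/funext => z; rewrite mxE.
  exact: psi_an.
apply/seteqP; split=> [x [[Xx Ux] _]|x [Ux px]].
  by split=> //; apply/XU.
by split=> //; split=> //; apply/XU.
Qed.

End GraphManifold.

(** * Orders of vanishing along curves *)

Section OrderOfVanishing.
Variables (R : realType) (n : nat).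
Implicit Types (F G : R -> R) (x y : R -> 'rV[R]_n) (f g : cps R n).

Definition Ot (k : nat) F := exists C, \forall t \near (0 : R)^'+, `|F t| <= C * t ^+ k.

Lemma near_pos : \forall t \near (0 : R)^'+, 0 < t.
Proof. exact: nbhs_right_gt. Qed.

Lemma near_le1 : \forall t \near (0 : R)^'+, t <= 1.
Proof. by apply: nbhs_right_le. Qed.

Lemma OtD k F G : Ot k F -> Ot k G -> Ot k (fun t => F t + G t).
Proof.
move=> [C FC] [D GD]; exists (C + D); near=> t.
apply: le_trans (ler_normD _ _) _; rewrite mulrDl lerD//; by near: t.
Unshelve. all: by end_near. Qed.

Lemma OtN k F : Ot k F -> Ot k (fun t => - F t).
Proof. by move=> [C FC]; exists C; near=> t; rewrite normrN; near: t.
Unshelve. all: by end_near. Qed.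

Lemma OtM j k F G : Ot j F -> Ot k G -> Ot (j + k) (fun t => F t * G t).
Proof.
move=> [C FC] [D GD]; exists (C * D); near=> t.
by rewrite normrM exprD mulrACA ler_pM//; near: t.
Unshelve. all: by end_near. Qed.

Lemma Ot_cst (c : R) : Ot 0 (fun=> c).
Proof. by exists `|c|; near=> t; rewrite expr0 mulr1.
Unshelve. all: by end_near. Qed.

Lemma Ot_id : Ot 1 (fun t => t).
Proof. by exists 1; near=> t; rewrite mul1r expr1 gtr0_norm//; near: t; exact: near_pos.
Unshelve. all: by end_near. Qed.

Lemma Ot_near k F G : (\forall t \near (0 : R)^'+, F t = G t) -> Ot k F -> Ot k G.
Proof. by move=> FG [C FC]; exists C; apply: filterS2 FG FC => t <-.
Qed.

Lemma Ot_sum k (T : Type) (r : seq T) (F : T -> R -> R) :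
  (forall i, Ot k (F i)) -> Ot k (fun t => \sum_(i <- r) F i t).
Proof.
move=> FO; elim: r => [|i r IH].
  by exists 0; near=> t; rewrite big_nil normr0 mul0r.
by under eq_fun do rewrite big_cons; exact: OtD.
Unshelve. all: by end_near. Qed.

Lemma Ot_lead k (c : R) : Ot k.+1 (fun t => t ^+ k * c) -> c = 0.
Proof.
move=> [C FC]; apply/eqP; apply: contrapT => /negP c0.
have C1 : 0 < `|C| + 1 by rewrite ltr_wpDl.
have : \forall t \near (0 : R)^'+, t < `|c| / (`|C| + 1).
  by apply: nbhs_right_lt; rewrite divr_gt0// normr_gt0.
move=> ht; have [t [t0 [tc tC]]] := filter_ex (filterI near_pos (filterI ht FC)).
move: tC; rewrite normrM (ger0_norm (exprn_ge0 _ (ltW t0))) exprSr mulrCA.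
rewrite ler_pM2l ?exprn_gt0// leNgt => /negP; apply.
move: tc; rewrite ltr_pdivlMr// => /(le_lt_trans _); apply.
rewrite [leRHS]mulrC ler_wpM2r ?(ltW t0)//.
by apply: le_trans (ler_norm C) _; rewrite lerDl.
Unshelve. all: by end_near. Qed.

Definition curve_Ot k x := forall i, Ot k (fun t => x t 0 i).

Lemma curve_bound x : curve_Ot 1 x -> exists2 C, 0 < C &
  \forall t \near (0 : R)^'+, forall i, `|x t 0 i| <= C * t.
Proof.
move=> xO; have /choice[C CP] i : exists C, \forall t \near (0 : R)^'+, `|x t 0 i| <= C * t.
  by have [C xC] := xO i; exists C.
exists (1 + \sum_i `|C i|); first by rewrite ltr_pwDl// sumr_ge0.
apply: (@filter_forall _ _ (fun i t => `|x t 0 i| <= (1 + \sum_i `|C i|) * t)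
  ((0 : R)^'+) _) => i.
near=> t; have xt : `|x t 0 i| <= C i * t by near: t.
have t0 : 0 < t by near: t; exact: near_pos.
apply: le_trans xt _; rewrite ler_wpM2r ?(ltW t0)//.
apply: le_trans (ler_norm _) _; rewrite (bigD1 i)//= addrCA lerDl.
by rewrite addr_ge0// sumr_ge0.
Unshelve. all: by end_near. Qed.

Lemma curve_near x (P : set 'rV[R]_n) : curve_Ot 1 x -> nbhs (0 : 'rV[R]_n) P ->
  \forall t \near (0 : R)^'+, P (x t).
Proof.
move=> /curve_bound[C C0 xC] /nbhs_ballP[e /= e0 eP]; near=> t.
apply: eP; split=> // i j; rewrite !mxE /ball /= sub0r normrN (ord1 i).
have xt : forall i, `|x t 0 i| <= C * t by near: t.
apply: le_lt_trans (xt j) _; rewrite mulrC -ltr_pdivlMr//.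
by near: t; apply: nbhs_right_lt; rewrite divr_gt0.
Unshelve. all: by end_near. Qed.

Lemma fps_sum_Ot f N x : ordge N f -> curve_Ot 1 x -> Ot N (fun t => fps_sum f (x t)).
Proof.
move=> fN xO; have [r r0 fr] := cps_conv f.
have [D D0 fD] := fps_sum_ordge r0 fr fN.
have [C C0 xC] := curve_bound xO.
exists (D * C ^+ N); near=> t; have t0 : 0 < t by near: t; exact: near_pos.
rewrite -mulrA -exprMn; apply: fD.
- by rewrite mulr_ge0// ltW.
- rewrite mulrC -ler_pdivlMr//; near: t; apply: nbhs_right_le.
  by rewrite divr_gt0.
- by near: t.
Unshelve. all: by end_near. Qed.

Definition lin f (w : 'rV[R]_n) : R := \sum_l coef f (mnm1 l) * w 0 l.

Lemma fps_sum_lin f x : curve_Ot 1 x ->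
  Ot 2 (fun t => fps_sum f (x t) - (coef f mnm0 + lin f (x t))).
Proof.
move=> xO; pose L : cps R n := cpsC n (coef f mnm0) +
  \sum_l cpsC n (coef f (mnm1 l)) * cpsU R l.
have LE m : coef L m = (if m == mnm0 then coef f mnm0 else 0) +
    \sum_l coef f (mnm1 l) * (m == mnm1 l)%:R.
  rewrite /L val_cpsD fpsD val_cps_sum fps_sumE; congr (_ + _).
  by apply: eq_bigr => l _; rewrite val_cpsM fpsCM coef_cpsU.
have fL : ordge 2 (f - L : cps R n).
  move=> m; rewrite ltnS leq_eqVlt ltnS leqn0 => /orP[/mdeg1P[i /eqP ->]|].
    rewrite val_cpsB fpsB LE mnm1_eq0 add0r (bigD1 i)//= eqxx mulr1 big1 ?addr0 ?subrr// => l li.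
    by rewrite eq_mnm1 eq_sym (negbTE li) mulr0.
  rewrite mdeg_eq0 => /eqP ->; rewrite val_cpsB fpsB LE eqxx big1 ?addr0 ?subrr// => l _.
  by rewrite eq_sym mnm1_eq0 mulr0.
apply: Ot_near (fps_sum_Ot fL xO); near=> t.
have cC (l : 'I_n) : abs_converges (cpsC n (coef f (mnm1 l)) * cpsU R l : cps R n) (x t).
  by apply: abs_convergesM; [exact: abs_converges_fpsC|exact: abs_converges_fpsX].
have [cS sE] := fps_sum_big (index_enum _) cC.
have cL : abs_converges L (x t).
  rewrite /L val_cpsD val_cps_sum; apply: abs_convergesD => //.
  exact: abs_converges_fpsC.
rewrite val_cpsB fps_sumB//; last first.
  by near: t; apply: (curve_near xO); exact: cps_convergent.
congr (_ - _); rewrite /L val_cpsD fps_sumD ?val_cps_sum//; last first.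
  exact: abs_converges_fpsC.
rewrite fps_sumC sE; congr (_ + _); apply: eq_bigr => l _.
rewrite fps_sumM ?fps_sumC ?fps_sumX ?mon1//.
  exact: abs_converges_fpsC.
exact: abs_converges_fpsX.
Unshelve. all: by end_near. Qed.

Lemma OtS k F : Ot k.+1 F -> Ot k F.
Proof.
move=> [C FC]; exists `|C|; near=> t.
have t0 : 0 < t by near: t; exact: near_pos.
have t1 : t <= 1 by near: t; exact: near_le1.
have Ft : `|F t| <= C * t ^+ k.+1 by near: t.
apply: le_trans Ft _; apply: le_trans (ler_wpM2r _ (ler_norm C)) _.
  by rewrite exprn_ge0// ltW.
by rewrite ler_wpM2l// ler_wiXn2l// ltW.
Unshelve. all: by end_near. Qed.

(** By induction over the factors, through [F F' - G G' = F (F' - G') + (F - G) G']: tangent curves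
    give the same monomial up to one extra order. *)
Lemma mon_Ot x y m : curve_Ot 1 x -> curve_Ot 1 y ->
  (forall i, Ot 2 (fun t => x t 0 i - y t 0 i)) ->
  Ot (mdeg m).+1 (fun t => mon (x t) m - mon (y t) m).
Proof.
move=> xO yO xyO; rewrite mdegE.
pose P k F G := [/\ Ot k F, Ot k G & Ot k.+1 (fun t => F t - G t)].
have PM j k F G F' G' : P j F G -> P k F' G' ->
    P (j + k)%N (fun t => F t * F' t) (fun t => G t * G' t).
  move=> [FO GO FG] [FO' GO' FG']; split; [exact: OtM|exact: OtM|].
  have H1 := OtM FO FG'; have H2 := OtM FG GO'; rewrite addnS in H1; rewrite addSn in H2.
  have := OtD H1 H2; apply: Ot_near; near=> t; ring.
have P1 : P 0%N (fun=> 1) (fun=> 1).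
  split; [exact: Ot_cst|exact: Ot_cst|].
  by exists 0; near=> t; rewrite subrr normr0 mul0r.
have PX i k : P k (fun t => x t 0 i ^+ k) (fun t => y t 0 i ^+ k).
  elim: k => [|k IH] //.
  have E (z : R -> 'rV[R]_n) : (fun t : R => z t 0 i ^+ k.+1) = (fun t => z t 0 i * z t 0 i ^+ k).
    by apply/funext => t; rewrite exprS.
  by rewrite !E; apply: (PM 1%N).
suff H (r : seq 'I_n) : P (\sum_(i <- r) m i)%N
    (fun t => \prod_(i <- r) x t 0 i ^+ m i) (fun t => \prod_(i <- r) y t 0 i ^+ m i).
  by case: (H (index_enum _)).
elim: r => [|i r IH].
  have E (z : R -> 'rV[R]_n) : (fun t => \prod_(i <- [::]) z t 0 i ^+ m i) = (fun=> 1 : R).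
    by apply/funext => t; rewrite big_nil.
  by rewrite big_nil !E.
have E (z : R -> 'rV[R]_n) : (fun t : R => \prod_(j <- i :: r) z t 0 j ^+ m j) =
    (fun t => z t 0 i ^+ m i * \prod_(j <- r) z t 0 j ^+ m j).
  by apply/funext => t; rewrite big_cons.
by rewrite big_cons !E; exact: PM.
Unshelve. all: by end_near. Qed.

Definition homog (k : nat) f : fps R n := fun m => if mdeg m == k then coef f m else 0.

Lemma homog_supported k f : supported_lt k.+1 (homog k f).
Proof. by move=> m km; rewrite /homog gtn_eqF. Qed.

(* The lowest homogeneous part of a series vanishing along a curve tangent to w
   vanishes at w. *)
Lemma homog_vanish f k x (w : 'rV[R]_n) : ordge k f -> curve_Ot 1 x ->
  (forall i, Ot 2 (fun t => x t 0 i - t * w 0 i)) ->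
  (\forall t \near (0 : R)^'+, fps_sum f (x t) = 0) ->
  fps_sum (homog k f) w = 0.
Proof.
move=> fk xO xw fx0; have cH z := supported_lt_abs_converges z (@homog_supported k f).
pose hk : cps R n := mkcps (supported_lt_convergent (@homog_supported k f)).
have ord : ordge k.+1 (f - hk : cps R n).
  move=> m; rewrite ltnS leq_eqVlt val_cpsB fpsB /= /homog => /orP[/eqP ->|mk].
    by rewrite eqxx subrr.
  by rewrite (fk _ mk) ltn_eqF// subrr.
have yO : curve_Ot 1 (fun t => t *: w).
  move=> i; apply: Ot_near (OtM Ot_id (Ot_cst (w 0 i))); near=> t.
  by rewrite mxE.
have xyO i : Ot 2 (fun t => x t 0 i - (t *: w) 0 i).
  by apply: Ot_near (xw i); near=> t; rewrite mxE.
have diff : Ot k.+1 (fun t => fps_sum hk (x t) - fps_sum hk (t *: w)).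
  have : Ot k.+1 (fun t => \sum_(m : bmultinom n k.+1) homog k f m *
      (mon (x t) m - mon (t *: w) m)).
    apply: Ot_sum => m; rewrite /homog; case: eqP => [mk|_]; last first.
      by exists 0; near=> t; rewrite mul0r normr0 mul0r.
    by have := OtM (Ot_cst (coef f m)) (mon_Ot m xO yO xyO); rewrite add0n mk.
  apply: Ot_near; near=> t; rewrite !(supported_lt_fps_sum _ (@homog_supported k f)).
  by rewrite /psum -sumrB; apply: eq_bigr => m _; rewrite mulrBr.
(* On the tangent line [hk] equals exactly [t ^+ k] times its value at [w]; [f] vanishes on the
   curve, and both errors have order [k + 1]. *)
have lead : Ot k.+1 (fun t => t ^+ k * fps_sum hk w).
  have := OtN (OtD (fps_sum_Ot ord xO) diff); apply: Ot_near; near=> t.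
  have fxt : fps_sum f (x t) = 0 by near: t.
  have cf : abs_converges f (x t).
    by near: t; apply: (curve_near xO); exact: cps_convergent.
  have cHx : abs_converges hk (x t) := cH (x t).
  rewrite val_cpsB (fps_sumB cf cHx) fxt.
  have -> : fps_sum hk (t *: w) = t ^+ k * fps_sum hk w; last by ring.
  rewrite !(supported_lt_fps_sum _ (@homog_supported k f)) /psum mulr_sumr.
  apply: eq_bigr => m _; rewrite !fps_termE /homog; case: eqP => [mk|_].
    by rewrite monZ mk mulrCA.
  by rewrite !mul0r mulr0.
exact: Ot_lead lead.
Unshelve. all: by end_near. Qed.

End OrderOfVanishing.

Section ManifoldPoint.
Variables (R : realType) (n : nat) (X : set 'rV[R]_n).
Hypothesis X0 : X 0.
Let K := germ_set X.
Let idK : ideal K := germ_set_ideal X0.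
Let K1 : ~ K 1 := @germ_set1 _ _ _ X0.

(* The vectors [lin G w] are the ones annihilated by the linear parts of K. For
   such a vector tau, the chart produces a curve in X tangent to tau at 0. *)
Lemma manifold_off_pivots_free : manifold_point X 0 -> off_pivots_free K.
Proof.
move=> [_ [U0 [openU0 U00 [d _ sub]]]].
have [U [V [phi [[openU U0'] openV [phi_bij [psi [psiK phi_an psi_an]]] XU]]]] :=
  sub 0 (conj X0 U00).
have [phiV _ phi_surj] := phi_bij.
have [G [KG Goff Gfree]] := pivot_solutions idK.
move=> g Kg goff; apply: contrapT => g0.
have [|a ga] := @initial_exists _ _ (g : fps R n).
  by apply/eqP => g0'; apply: g0; apply: val_inj.
pose k := mdeg a.
have gk : ordge k g.
  by move=> m mk; have [_ ->//] := ga; apply: lt_mdeg_ltmc.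
have phiUE h : (X `&` U0 `&` U) h -> forall i : 'I_n, (d <= i)%N -> phi h 0 i = 0.
  by rewrite XU => -[].
have /choice[s sE] i : exists s : cps R n, \forall h \near (0 : 'rV[R]_n),
    phi (0 + h) 0 i = fps_sum s h by exact: phi_an.
have /choice[q qE] j : exists q : cps R n, \forall h \near (0 : 'rV[R]_n),
    psi (phi 0 + h) 0 j = fps_sum q h by apply: psi_an; exact: phiV.
have s0 i : coef (s i) mnm0 = phi 0 0 i.
  by have := nbhs_singleton (sE i); rewrite addr0 fps_sum_at0.
have q0 j : coef (q j) mnm0 = 0.
  by have := nbhs_singleton (qE j); rewrite addr0 fps_sum_at0 psiK// mxE.
(* The chart coordinates that vanish on [X] are themselves germs in [K]. *)
have Ks (i : 'I_n) : (d <= i)%N -> K (s i).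
  move=> di; rewrite /K /germ_set /= /vanishes_near_origin; near=> h.
  split=> [|Xh]; first by near: h; exact: cps_convergent.
  rewrite (_ : fps_sum (s i) h = phi (0 + h) 0 i); last by apply/esym; near: h; exact: sE.
  rewrite add0r; apply: phiUE => //; split; first split=> //.
    by near: h; exact: open_nbhs_nbhs.
  by near: h; exact: open_nbhs_nbhs.
(* A homogeneous part vanishing everywhere is 0 by the identity theorem, which contradicts the
   initial coefficient at [a], of degree [k]. *)
suff hw w : fps_sum (homog k g) w = 0.
  have [ga0 _] := ga; move/eqP: ga0; apply.
  have := @fps_identity _ _ (homog k g)
    (supported_lt_convergent (@homog_supported _ _ k g)) _.
  move=> /(_ (filterE _ hw)) /(congr1 (fun f : fps R n => f a)).
  by rewrite /homog eqxx.
(* [tau] completes the free coordinates of [w] by the linear parts of the [G j]; [u] is the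
   derivative of [phi] at 0 in direction [tau]. *)
pose tau : 'rV[R]_n := \row_j lin (G j) w.
pose u : 'rV[R]_n := \row_i lin (s i) tau.
have lin_tau f : K f -> lin f tau = 0.
  move=> Kf; rewrite /lin; under eq_bigr do rewrite mxE /lin mulr_sumr.
  rewrite exchange_big big1// => l _.
  under eq_bigr do rewrite mulrA; rewrite -mulr_suml.
  by have := lin_free_K idK K1 KG Goff l Kf; rewrite /lin_free => ->; rewrite mul0r.
have tau_free l : l \in free K -> tau 0 l = w 0 l.
  move=> lf; rewrite mxE (Gfree _ lf) /lin (bigD1 l)// big1 => [|j jl].
    by rewrite coef_cpsU eqxx; apply: etrans (addr0 _) (mul1r _).
  by rewrite coef_cpsU eq_mnm1 (negbTE jl) mul0r.
have lineO (v : 'rV[R]_n) : curve_Ot 1 (fun t : R => t *: v : 'rV[R]_n).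
  move=> i; apply: Ot_near (OtM (@Ot_id R) (Ot_cst (v 0 i))); near=> t.
  by rewrite mxE.
have lin_sum (f : cps R n) (x : R -> 'rV[R]_n) : curve_Ot 1 x -> coef f mnm0 = 0 ->
    Ot 2 (fun t => fps_sum f (x t) - lin f (x t)).
  by move=> /(fps_sum_lin f) + f0; apply: Ot_near; near=> t; rewrite f0 add0r.
have linZ (f : cps R n) (t : R) (v : 'rV[R]_n) : lin f (t *: v) = t * lin f v.
  by rewrite /lin mulr_sumr; apply: eq_bigr => l _; rewrite mxE mulrCA.
(* h1 = phi (t tau) - phi 0 = t u + O(t^2) *)
pose h1 (t : R) : 'rV[R]_n := phi (t *: tau) - phi 0.
have h1u i : Ot 2 (fun t => h1 t 0 i - t * u 0 i).
  apply: Ot_near (fps_sum_lin (s i) (lineO tau)); near=> t.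
  rewrite s0 linZ /h1 !mxE opprD addrA; congr (_ - _ - _).
  apply/esym; rewrite -[X in phi X 0 i = _]add0r; near: t.
  exact: (curve_near (lineO tau) (sE i)).
have tuO i : Ot 1 (fun t => t * u 0 i).
  by have := OtM (@Ot_id R) (Ot_cst (u 0 i)).
have h1O : curve_Ot 1 h1.
  move=> i; have := OtD (OtS (h1u i)) (tuO i).
  by apply: Ot_near; near=> t; rewrite subrK.
(* The chain rule for [psi (phi (t *: tau)) = t *: tau], read off at first order in [t]. *)
have tau_u j : lin (q j) u = tau 0 j.
  apply/eqP; rewrite -subr_eq0; apply/eqP; apply: (@Ot_lead _ 1).
  have H1 := lin_sum _ _ h1O (q0 j).
  have H2 : Ot 2 (fun t => lin (q j) (h1 t) - t * lin (q j) u).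
    have : Ot 2 (fun t => \sum_l coef (q j) (mnm1 l) * (h1 t 0 l - t * u 0 l)).
      by apply: Ot_sum => l; have := OtM (Ot_cst (coef (q j) (mnm1 l))) (h1u l).
    apply: Ot_near; near=> t; rewrite /lin mulr_sumr -sumrB.
    by apply: eq_bigr => l _; ring.
  have := OtN (OtD H1 H2); apply: Ot_near; near=> t.
  rewrite (_ : fps_sum (q j) (h1 t) = (t *: tau) 0 j); first by rewrite mxE expr1; ring.
  rewrite -(psiK (t *: tau)).
    rewrite -[X in psi X 0 j](subrKC (phi 0)); apply/esym.
    by near: t; exact: (curve_near h1O (qE j)).
  by near: t; apply: (curve_near (lineO tau)); exact: open_nbhs_nbhs.
(* The straight line in direction [u] is pulled back through the chart. It stays in the flat piece
   because the coordinates of [u] of index at least [d] are linear parts of elements of [K] at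
   [tau], hence 0. *)
pose x (t : R) := psi (phi 0 + t *: u).
have xtau j : Ot 2 (fun t => x t 0 j - t * tau 0 j).
  have := lin_sum _ _ (lineO u) (q0 j); apply: Ot_near; near=> t.
  rewrite linZ tau_u; congr (_ - _); apply/esym; near: t.
  exact: (curve_near (lineO u) (qE j)).
have xO : curve_Ot 1 x.
  move=> j; have := OtD (OtS (xtau j)) (OtM (@Ot_id R) (Ot_cst (tau 0 j))).
  by apply: Ot_near; near=> t; rewrite subrK.
have xX : \forall t \near (0 : R)^'+, X (x t).
  near=> t; have Vt : V (phi 0 + t *: u).
    near: t; apply: (curve_near (lineO u) (P := fun h => V (phi 0 + h))).
    have : nbhs (phi 0) V by apply: open_nbhs_nbhs; split=> //; exact: phiV.
    move=> /nbhs_ballP[e /= e0 eV]; apply/nbhs_ballP; exists e => // h [_ he].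
    apply: eV; split=> // i j; have := he i j.
    by rewrite !mxE /ball /= sub0r normrN opprD addrA subrr sub0r normrN.
  have [z Uz zE] := phi_surj _ Vt.
  suff : (X `&` U0 `&` U) (x t) by case=> -[].
  rewrite XU /x -zE (psiK _ Uz); split=> // i di.
  have phi0 : phi 0 0 i = 0 by apply: phiUE.
  by rewrite zE !mxE phi0 add0r (lin_tau _ (Ks _ di)) mulr0.
have gx : \forall t \near (0 : R)^'+, fps_sum g (x t) = 0.
  near=> t; have [_ h] : abs_converges g (x t) /\ (X (x t) -> fps_sum g (x t) = 0).
    by near: t; exact: (curve_near xO Kg).
  by apply: h; near: t.
(* The homogeneous part is off the pivots, so it takes the same value at [w] and at [tau]. *)
rewrite -[RHS](homog_vanish gk xO xtau gx).
pose hk : cps R n := mkcps (supported_lt_convergent (@homog_supported _ _ k g)).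
apply: (@fps_sum_off_pivots _ _ K hk) => [m|l lf]; last by rewrite tau_free.
by rewrite /= /homog; case: (mdeg m == k); [exact: goff|rewrite eqxx].
Unshelve. all: by end_near. Qed.

End ManifoldPoint.

Theorem theorem4p3 (R : realType) (n : nat) (I : set (mpoly n R))
    (I_ideal : ideal I) (I_origin : I `<=` @origin_ideal R n) :
  manifold_point (real_zero_set I) (0 : 'rV[R]_n) <->
  regular_local_ring (germ_ring (real_zero_set_origin I_origin)).
Proof.
set X0 := real_zero_set_origin I_origin.
have idK := germ_set_ideal X0; have K1 := germ_set1 X0.
(* The canonical surjection, whose kernel is the ideal of germs vanishing on the zero set, links the
   quotient ring to the pivot condition. *)
pose pr : {rmorphism cps R n -> germ_ring X0} := \pi_(germ_ring X0)%qT.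
have pr_surj a : exists f, pr f = a by exists (repr a); exact: reprK.
have pr_ker f : pr f = 0 <-> germ_set (real_zero_set I) f.
  rewrite (germ_setP X0) -[f in f \in _]subr0 Quotient.idealrBE -[0 in RHS](rmorph0 pr).
  by split=> [/eqP|/eqP].
split=> [mX|regX].
  apply: (off_pivots_free_regular idK K1 pr_surj pr_ker).
  exact: manifold_off_pivots_free X0 mX.
apply: off_pivots_free_manifold => //.
exact: (regular_off_pivots_free idK K1 pr_surj pr_ker).
Qed.
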